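(* Let $l_1$ be a natural number and $m_1$ an integer with $1<|m_1|\le l_1$. Then: (i) for any integer $m$ with $2\le m\le m_1$ we have $MC(e_{l_1\,m_1},e_{m\,-m})>0$. (ii) For any $l_1\ge 3$ we have $MC(e_{l_1\,1},e_{l_2\,1})>0$ for any integer $l_2$ with $2\le l_2<l_1$.
   Context: Use coordinates $(\lambda,\mu)\in(0,2\pi)\times(-1,1)$ on the unit sphere $\mathbb S^2$ ($\lambda$ longitude, $\mu$ height), with area element $d\lambda\,d\mu$ and Laplace–Beltrami operator $\Delta$. The Poisson bracket is $\{f,g\}=\partial_\lambda f\,\partial_\mu g-\partial_\mu f\,\partial_\lambda g$, extended complex-bilinearly to complex-valued functions, and $\langle f,g\rangle=\int_{\mathbb S^2} f\,g^*\,d\lambda\,d\mu$, where $^*$ is complex conjugation. For integers $l\ge 0$, $|m|\le l$, $Y_{lm}$ denotes the complex spherical harmonic: for $m\ge 0$, $Y_{lm}=(-1)^m\sqrt{\frac{2l+1}{4\pi}\frac{(l-m)!}{(l+m)!}}\,P_l^m(\mu)e^{im\lambda}$ with $P_l^m(\mu)=\frac{(1-\mu^2)^{m/2}}{2^l l!}\frac{d^{l+m}}{d\mu^{l+m}}(\mu^2-1)^l$, and $Y_{l\,-m}=(-1)^mY_{lm}^*$. These are orthonormal with $\Delta Y_{lm}=-l(l+1)Y_{lm}$. Put $\nabla^\perp f=(-\partial_\mu f,\partial_\lambda f)$ and $e_{lm}=\nabla^\perp Y_{lm}$. The Misiolek criterion of $u=\nabla^\perp f$, $v=\nabla^\perp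 g$ is $$MC(u,v)=\langle\Delta\{f,g\},\{f,g\}\rangle-\langle\{\Delta f,g\},\{f,g\}\rangle.$$ *)

(* Defs.v *)
From Stdlib Require Export Reals ZArith ClassicalEpsilon.
From Coquelicot Require Export Coquelicot.
Open Scope R_scope.

(** Complex-valued functions on the sphere in coordinates (lambda, mu) with
    0 < lambda < 2 PI and -1 < mu < 1; values outside this chart never matter. *)
Definition cfun := R -> R -> C.

Definition in_chart (lam mu : R) : Prop := 0 < lam < 2 * PI /\ -1 < mu < 1.

Definition ex_DeriveC (h : R -> C) (x : R) : Prop :=
  ex_derive (fun t => Re (h t)) x /\ ex_derive (fun t => Im (h t)) x.

Definition DeriveC (h : R -> C) (x : R) : C :=
  (Derive (fun t => Re (h t)) x, Derive (fun t => Im (h t)) x).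

Definition d_lam (f : cfun) : cfun := fun lam mu => DeriveC (fun t => f t mu) lam.
Definition d_mu (f : cfun) : cfun := fun lam mu => DeriveC (fun t => f lam t) mu.

(** The round metric reads dmu^2 / (1 - mu^2) + (1 - mu^2) dlambda^2, with
    determinant 1. *)
Definition laplacian (f : cfun) : cfun := fun lam mu =>
  (d_mu (fun l t => RtoC (1 - t ^ 2) * d_mu f l t) lam mu
   + RtoC (/ (1 - mu ^ 2)) * d_lam (d_lam f) lam mu)%C.

Definition bracket (f g : cfun) : cfun := fun lam mu =>
  (d_lam f lam mu * d_mu g lam mu - d_mu f lam mu * d_lam g lam mu)%C.

(** Iterated Riemann integral, for the area element dlambda dmu. *)
Definition inner (f g : cfun) : C :=
  RInt (V := C_R_CompleteNormedModule)
    (fun mu => RInt (V := C_R_CompleteNormedModule)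
       (fun lam => (f lam mu * Cconj (g lam mu))%C) 0 (2 * PI))
    (-1) 1.

(** Meant for m <= l. On the chart 1 - mu^2 > 0, so that
    sqrt (1 - mu^2) ^ m is (1 - mu^2)^(m/2). *)
Definition legendre (l m : nat) (mu : R) : R :=
  sqrt (1 - mu ^ 2) ^ m / (2 ^ l * INR (fact l))
  * Derive_n (fun x => (x ^ 2 - 1) ^ l) (l + m) mu.

Definition Ynat (l m : nat) : cfun := fun lam mu =>
  (RtoC ((-1) ^ m
         * sqrt ((2 * INR l + 1) / (4 * PI) * (INR (fact (l - m)) / INR (fact (l + m))))
         * legendre l m mu)
   * (cos (INR m * lam), sin (INR m * lam)))%C.

Definition Y (l : nat) (m : Z) : cfun := fun lam mu =>
  if (0 <=? m)%Z then Ynat l (Z.to_nat m) lam mu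
  else (RtoC ((-1) ^ Z.to_nat (- m)) * Cconj (Ynat l (Z.to_nat (- m)) lam mu))%C.

(** Complex vector fields, given by their two components. *)
Definition vfield := R -> R -> C * C.

Definition grad_perp (f : cfun) : vfield := fun lam mu =>
  (Copp (d_mu f lam mu), d_lam f lam mu).

Definition e (l : nat) (m : Z) : vfield := grad_perp (Y l m).

(** [Derive] is total, so differentiability has to be required separately. *)
Definition stream_of (u : vfield) (f : cfun) : Prop :=
  forall lam mu, in_chart lam mu ->
    ex_DeriveC (fun t => f t mu) lam /\ ex_DeriveC (fun t => f lam t) mu /\
    grad_perp f lam mu = u lam mu.

(** Some f with u = grad_perp f, if there is one. As the chart is a rectangle,
    f is unique there up to an additive constant, and [MC] involves f only
    through its derivatives, so that it does not depend on the choice. *)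
Definition stream (u : vfield) : cfun :=
  epsilon (inhabits (fun _ _ => RtoC 0)) (stream_of u).

Definition MC (u v : vfield) : C :=
  let f := stream u in
  let g := stream v in
  (inner (laplacian (bracket f g)) (bracket f g)
   - inner (bracket (laplacian f) g) (bracket f g))%C.

(** z > 0 for a complex number z: z is real and positive. *)
Definition Cpos (z : C) : Prop := Im z = 0 /\ 0 < Re z.

(* Main.v *)
Require Import Defs.
From Stdlib Require Import Lra Lia FunctionalExtensionality.
From mathcomp Require all_boot all_order ssralg ssrnum poly ring lra Rstruct.

(** Writing a function as [F(mu) e^{i m lambda}], both brackets reduce to one real integral:
    if [{f,g} = i H(mu) e^{i m lambda}] and [Delta f = - a f], then [MC] is [2 PI] times the
    integral of [((w H')' - m^2 H / w + a H) H] over [-1 < mu < 1], with [w = 1 - mu^2].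

    In (i), [Y_{m,-m}] is a multiple of [w^{m/2}], so that [H] is, up to a constant,
    [w^{(m-1)/2}] times the associated Legendre function of order [m1 - 1]; by the ODE of the
    latter the integrand is an exact derivative plus a nonnegative function.

    In (ii), with [p = P_{l1}'], [q = P_{l2}'], [n = l1 - 1], [k = l2 - 1], [a = n(n+3)] and
    [b = k(k+3)], the integral is that of [a w^2 (p q' - p' q)^2 - (a - b)^2 w p^2 q^2].
    Integrating by parts turns twice this into the integral of
    [w p^2 ((6ab - 2b^2) v + 3a (w v'' - 4 x v'))] for [v = q^2]. Expand [q^2] in the
    Gegenbauer polynomials [E_{2j}] of parameter 3/2. As [p^2] and [q^2] solve a third order
    ODE, both the coefficients of [q^2] and the moments of [p^2] against [E_{2j}] obey first
    order recurrences in [j]. The integral becomes a sum of terms [(6ab - 2b^2 - 6aj(2j+3)) T_j]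
    with [T_j > 0], and Chebyshev's sum inequality against the explicit weights
    [(4j + 3)(2(a + b) + 4 - 2j(2j + 3))] shows that it is positive. *)

(** * Polynomial inequalities and a weighted sum inequality *)

Ltac nonneg_coeffs :=
  match goal with |- 0 <= ?x => ring_simplify x end;
  repeat (apply Rplus_le_le_0_compat); repeat (apply Rmult_le_pos); try (apply pow_le); lra.

(** This says that [T / wt] does not increase from [j] to [j + 1], for the [T] of [gap_sum_gt0],
    once the common factors [4 j + 3] and [4 j + 7] are cancelled. Expanded in [j], [r] and [s], the
    difference has nonnegative coefficients. *)
Lemma ratio_ineq (j r s : R) : 0 <= j -> 0 <= r -> 0 <= s ->
  let N := 2 * j in let k := j + 1 + r in let n := k + 1 + s in
  let A := 2 * (n * (n + 3) + k * (k + 3)) + 4 in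
  0 <= (N + 2) ^ 3 * (N + 4) * ((2 * n + 3) ^ 2 - (N + 2) ^ 2) * ((2 * k + 3) ^ 2 - (N + 2) ^ 2) *
    (A - (N + 2) * (N + 5))
  - (N + 1) * (N + 3) ^ 3 * ((2 * n + 3) ^ 2 - (N + 3) ^ 2) * ((2 * k + 3) ^ 2 - (N + 3) ^ 2) *
    (A - N * (N + 3)).
Proof. intros Hj Hr Hs; cbv zeta; nonneg_coeffs. Qed.

(** For large [n, k, j] the terms [T_j] of the header behave like
    [j sqrt ((n^2 - j^2) (k^2 - j^2))]. Replacing the square root by the mean
    [(n^2 + k^2) / 2 - j^2] gives these weights; the lower order term [4] is chosen so that the
    polynomials below have nonnegative coefficients in [j, k - j, n - k - 1]. *)
Definition wt (n k j : R) : R := (4 * j + 3) *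
  (2 * (n * (n + 3) + k * (k + 3)) + 4 - 2 * j * (2 * j + 3)).

Definition gap (n k j : R) : R :=
  let a := n * (n + 3) in let b := k * (k + 3) in
  6 * a * b - 2 * b ^ 2 - 3 * a * (2 * j * (2 * j + 3)).

(** Closed form of the sum of [gap * wt] over [0 <= j <= m]. The factor [(m + 1) (2 m + 3)] is the
    sum of the [4 j + 3]; with these as weights, [2 j (2 j + 3)] has mean [c], and three times its
    square has mean [c (4 c + 2)]. *)
Definition gap_wt_sum (n k m : R) : R :=
  let a := n * (n + 3) in let b := k * (k + 3) in
  let A := 2 * (a + b) + 4 in let t := 6 * a * b - 2 * b ^ 2 in let c := m * (2 * m + 5) in
  (m + 1) * (2 * m + 3) * (A * t - c * (3 * a * A + t) + a * c * (4 * c + 2)).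

Lemma gap_wt_sum_0 n k : gap_wt_sum n k 0 = gap n k 0 * wt n k 0.
Proof. unfold gap_wt_sum, gap, wt; ring. Qed.

Lemma gap_wt_sum_S n k m :
  gap_wt_sum n k (m + 1) = gap_wt_sum n k m + gap n k (m + 1) * wt n k (m + 1).
Proof. unfold gap_wt_sum, gap, wt; ring. Qed.

Lemma gap_wt_sum_ge0 (m r s : R) : 0 <= m -> 0 <= r -> 0 <= s ->
  0 <= gap_wt_sum (m + r + 1 + s) (m + r) m.
Proof.
intros; unfold gap_wt_sum; cbv zeta.
apply Rmult_le_pos; [apply Rmult_le_pos; lra|]. nonneg_coeffs.
Qed.

(** The case [m = k], strict because [k = r + 1] is at least 1; for [k = 0] the sum vanishes. The
    last factor keeps nonnegative coefficients after 1 is subtracted from it. *)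
Lemma gap_wt_sum_gt0 (r s : R) : 0 <= r -> 0 <= s ->
  0 < gap_wt_sum (r + 2 + s) (r + 1) (r + 1).
Proof.
intros; unfold gap_wt_sum; cbv zeta.
apply Rmult_lt_0_compat; [apply Rmult_lt_0_compat; lra|].
apply Rminus_lt_0; apply (Rlt_le_trans _ 1); [lra|].
apply Rminus_le_0. rewrite Rminus_0_r. nonneg_coeffs.
Qed.

Lemma wt_gt0 (j r s : R) : 0 <= j -> 0 <= r -> 0 <= s -> 0 < wt (j + r + 1 + s) (j + r) j.
Proof.
intros; unfold wt. apply Rmult_lt_0_compat; [lra|].
apply Rminus_lt_0; apply (Rlt_le_trans _ 1); [lra|].
apply Rminus_le_0. rewrite Rminus_0_r. nonneg_coeffs.
Qed.

(** Chebyshev's sum inequality by Abel summation: [T / wt] is decreasing and the partial sums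
    of [gap * wt] are nonnegative. *)
Lemma gap_sum_gt0 (n k : nat) (T : nat -> R) : (1 <= k < n)%nat ->
  (forall j, (j <= k)%nat -> 0 < T j) ->
  (forall j, (j < k)%nat -> let N := 2 * INR j in
    T (S j) * ((N + 2) ^ 3 * (N + 4) * (2 * N + 3)
      * ((2 * INR n + 3) ^ 2 - (N + 2) ^ 2) * ((2 * INR k + 3) ^ 2 - (N + 2) ^ 2))
    = T j * ((N + 1) * (N + 3) ^ 3 * (2 * N + 7)
      * ((2 * INR n + 3) ^ 2 - (N + 3) ^ 2) * ((2 * INR k + 3) ^ 2 - (N + 3) ^ 2))) ->
  0 < sum_f_R0 (fun j => gap (INR n) (INR k) (INR j) * T j) k.
Proof.
intros [Hk Hn] HT Hrec.
set (W j := wt (INR n) (INR k) (INR j)).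
set (F m := gap_wt_sum (INR n) (INR k) (INR m)).
(* The gaps [k - j] and [n - k - 1] are the variables in which the polynomials above have
   nonnegative coefficients. *)
assert (split_nk : forall j, (j <= k)%nat -> exists r s, 0 <= r /\ 0 <= s /\
   INR k = INR j + r /\ INR n = INR j + r + 1 + s).
{ intros j Hj. exists (INR (k - j)), (INR (n - k - 1)).
  repeat split; try apply pos_INR.
  - rewrite <- plus_INR; f_equal; lia.
  - replace 1 with (INR 1) by reflexivity. rewrite <- !plus_INR; f_equal; lia. }
assert (HW : forall j, (j <= k)%nat -> 0 < W j).
{ intros j Hj. destruct (split_nk j Hj) as (r & s & Hr & Hs & Ek & En).
  unfold W; rewrite Ek, En. apply wt_gt0; auto using pos_INR. }
assert (HF : forall j, (j <= k)%nat -> 0 <= F j).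
{ intros j Hj. destruct (split_nk j Hj) as (r & s & Hr & Hs & Ek & En).
  unfold F; rewrite Ek, En. apply gap_wt_sum_ge0; auto using pos_INR. }
assert (Hdec : forall j, (j < k)%nat -> T (S j) * W j <= T j * W (S j)).
{ intros j Hj. destruct (split_nk (S j) Hj) as (r & s & Hr & Hs & Ek & En).
  generalize (ratio_ineq (INR j) r s (pos_INR j) Hr Hs); cbv zeta.
  generalize (Hrec j Hj); cbv zeta.
  generalize (HT j (Nat.lt_le_incl _ _ Hj)).
  unfold W, wt. rewrite S_INR in *. rewrite Ek, En.
  generalize (pos_INR j) (HT (S j) Hj).
  generalize (T j) (T (S j)). generalize (INR j). clear -Hr Hs.
  intros J t t' HJ Ht' Ht Erec HR.
  set (D := (2 * J + 2) ^ 3 * (2 * J + 4)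
        * ((2 * (J + 1 + r + 1 + s) + 3) ^ 2 - (2 * J + 2) ^ 2)
        * ((2 * (J + 1 + r) + 3) ^ 2 - (2 * J + 2) ^ 2)) in *.
  assert (HD : 0 < D).
  { unfold D. repeat apply Rmult_lt_0_compat; try apply pow_lt; try lra; nra. }
  set (E := (2 * J + 1) * (2 * J + 3) ^ 3
        * ((2 * (J + 1 + r + 1 + s) + 3) ^ 2 - (2 * J + 3) ^ 2)
        * ((2 * (J + 1 + r) + 3) ^ 2 - (2 * J + 3) ^ 2)) in *.
  set (A := 2 * ((J + 1 + r + 1 + s) * (J + 1 + r + 1 + s + 3) + (J + 1 + r) * (J + 1 + r + 3)) +
    4) in *.
  assert (Erec' : t' * (D * (4 * J + 3)) = t * (E * (4 * J + 7))).
  { unfold D, E. etransitivity; [etransitivity; [|exact Erec]|]; ring. }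
  apply (Rmult_le_reg_r (D * (4 * J + 3))); [nra|].
  replace (t' * ((4 * J + 3) * (A - 2 * J * (2 * J + 3))) * (D * (4 * J + 3)))
    with (t' * (D * (4 * J + 3)) * ((4 * J + 3) * (A - 2 * J * (2 * J + 3)))) by ring.
  rewrite Erec'.
  apply Rminus_le_0.
  match goal with |- 0 <= ?x => replace x with (t * (4 * J + 7) * (4 * J + 3) *
    (D * (A - (2 * J + 2) * (2 * J + 5)) - E * (A - 2 * J * (2 * J + 3)))) by ring end.
  apply Rmult_le_pos; [nra|exact HR]. }
(* Abel summation without division: the partial sum of [gap * T] is at least [F m * (T m / W m)]. In
   the induction step, [F m >= 0] allows the ratio [T m / W m] to be replaced by the smaller one at
   [S m]. *)
assert (HS : forall m, (m <= k)%nat ->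
  T m * F m <= W m * sum_f_R0 (fun j => gap (INR n) (INR k) (INR j) * T j) m).
{ induction m as [|m IH]; intros Hm.
  - right; unfold F; simpl; rewrite gap_wt_sum_0; unfold W; simpl; ring.
  - rewrite tech5.
    replace (F (S m)) with (F m + gap (INR n) (INR k) (INR (S m)) * W (S m))
      by (unfold F, W; rewrite S_INR, gap_wt_sum_S; reflexivity).
    specialize (IH (Nat.lt_le_incl _ _ Hm)). specialize (Hdec m Hm).
    specialize (HF m (Nat.lt_le_incl _ _ Hm)).
    pose proof (HW m (Nat.lt_le_incl _ _ Hm)) as W0. pose proof (HW (S m) Hm) as W1.
    set (S0 := sum_f_R0 _ m) in *. 
    assert (T (S m) * F m <= W (S m) * S0); [|lra].
    apply (Rmult_le_reg_r (W m)); [assumption|].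
    pose proof (Rmult_le_compat_r _ _ _ HF Hdec).
    pose proof (Rmult_le_compat_l _ _ _ (Rlt_le _ _ W1) IH). lra. }
specialize (HS k (le_n k)).
assert (F0 : 0 < F k).
{ unfold F. replace (INR n) with (INR (k - 1) + 2 + INR (n - k - 1)).
  - replace (INR k) with (INR (k - 1) + 1).
    + apply gap_wt_sum_gt0; apply pos_INR.
    + rewrite <- S_INR; f_equal; lia.
  - replace 2 with (INR 2) by (simpl; ring). rewrite <- !plus_INR; f_equal; lia. }
specialize (HW k (le_n k)). specialize (HT k (le_n k)).
apply (Rmult_lt_reg_l (W k)); [assumption|]. rewrite Rmult_0_r.
pose proof (Rmult_lt_0_compat _ _ HT F0). lra.
Qed.

(** For [n >= l] this is [2^l l!] times the derivative of order [n - l] of the Legendre polynomial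
    [P_l], by Rodrigues' formula. *)
Definition rod (l n : nat) (x : R) : R := Derive_n (fun t => (t ^ 2 - 1) ^ l) n x.

(** * Polynomials *)

Module Polynomials.
Import all_boot all_order ssralg ssrnum poly ring lra Rstruct.
Import Order.TTheory GRing.Theory Num.Theory.
Local Open Scope ring_scope.
Set Implicit Arguments.
Unset Strict Implicit.

(** Reduces an equation to a [ring] identity: the difference of its sides is exhibited as a
    combination of the differences in known equations. *)
Lemma lin_comb1 (V : pzRingType) (c a b l r : V) :
  l = r -> a - b = c * (l - r) -> a = b.
Proof. by move=> ->; rewrite subrr mulr0 => /subr0_eq. Qed.

Lemma lin_comb2 (V : pzRingType) (c c' a b l r l' r' : V) :
  l = r -> l' = r' -> a - b = c * (l - r) + c' * (l' - r') -> a = b.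
Proof. by move=> -> ->; rewrite !subrr !mulr0 addr0 => /subr0_eq. Qed.

Lemma lin_comb3 (V : pzRingType) (c c' c'' a b l r l' r' l'' r'' : V) :
  l = r -> l' = r' -> l'' = r'' ->
  a - b = c * (l - r) + c' * (l' - r') + c'' * (l'' - r'') -> a = b.
Proof. by move=> -> -> ->; rewrite !subrr !mulr0 !addr0 => /subr0_eq. Qed.

(** * Formal integration of polynomials over [-1, 1] *)

Section Integral.
Variable (R : realFieldType).
Implicit Types p q : {poly R}.

(** At [i = 0] the division by zero yields 0, so this primitive vanishes at the origin. *)
Definition prim p := \poly_(i < (size p).+1) (p`_i.-1 / i%:R).

Lemma deriv_prim p : (prim p)^`() = p.
Proof.
apply/polyP => i; rewrite coef_deriv coef_poly ltnS /=.
case: ltnP => [_|le_i]; last by rewrite nth_default // mul0rn.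
by rewrite -[LHS]mulr_natr mulfVK // pnatr_eq0.
Qed.

Lemma deriv_eq0_const p : p^`() = 0 -> p = (p`_0)%:P.
Proof.
move=> dp; apply/polyP => -[|i]; rewrite coefC //=.
have := congr1 (fun r : {poly R} => r`_i) dp; rewrite coef_deriv coef0 => /eqP.
by rewrite mulrn_eq0 => /orP [//|/eqP].
Qed.

Definition Int p := (prim p).[1] - (prim p).[-1].

Lemma Int_deriv p : Int p^`() = p.[1] - p.[-1].
Proof.
have /deriv_eq0_const h : (prim p^`() - p)^`() = 0 by rewrite derivB deriv_prim subrr.
have {}h : prim p^`() = p + ((prim p^`() - p)`_0)%:P by rewrite -h addrC subrK.
by rewrite /Int h ?(hornerD, hornerN, hornerM, hornerC, hornerX); ring.
Qed.

Lemma IntD p q : Int (p + q) = Int p + Int q.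
Proof.
have -> : p + q = (prim p + prim q)^`() by rewrite derivD !deriv_prim.
by rewrite Int_deriv ?(hornerD, hornerN, hornerM, hornerC, hornerX) /Int; ring.
Qed.

Lemma IntZ c p : Int (c%:P * p) = c * Int p.
Proof.
have -> : c%:P * p = (c%:P * prim p)^`() by rewrite derivM derivC mul0r add0r deriv_prim.
by rewrite Int_deriv ?(hornerD, hornerN, hornerM, hornerC, hornerX) /Int; ring.
Qed.

End Integral.

(** * Gegenbauer polynomials and squares of solutions of their equation *)

Section Gegenbauer.
Variable (R : realFieldType).
Implicit Types p q u v : {poly R}.
Let w : {poly R} := 1 - 'X ^+ 2.

(** The Gegenbauer polynomials of parameter 3/2. *)
Fixpoint gegen (n : nat) : {poly R} :=
  if n is n'.+1 then
    if n' is n''.+1 then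
      (n'.+1%:R^-1)%:P * ((2 * n'%:R + 3)%:P * 'X * gegen n' - (n'.+2)%:R%:P * gegen n'')
    else 3%:P * 'X
  else 1.

Lemma gegenSS n : n.+2%:R * gegen n.+2 = (2 * n%:R + 5) * 'X * gegen n.+1 - (n%:R + 3) * gegen n.
Proof.
rewrite [gegen n.+2]/= -/(gegen n.+1) mulrA -polyC_natr -polyCM mulfV ?pnatr_eq0 // mul1r.
by rewrite !polyCD !polyCM !polyC_natr; ring.
Qed.

Lemma w_neq0 : w != 0.
Proof.
apply/eqP => h; have := congr1 (fun r : {poly R} => r.[0]) h.
by rewrite /w hornerD hornerN hornerXn hornerC expr0n /= subr0 horner0 => /eqP; rewrite oner_eq0.
Qed.

Lemma deriv_w : w^`() = - 2%:R * 'X.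
Proof. by rewrite /w !derivE /=; ring. Qed.

(** Ladder relations, proved together. The first at [n + 1] is the second at [n] rewritten by the
    three-term recurrence; the second at [n + 1] comes from differentiating that recurrence. *)
Lemma gegen_deriv n :
  w * (gegen n)^`() = (n%:R + 3) * 'X * gegen n - (n%:R + 1) * gegen n.+1 /\
  w * (gegen n.+1)^`() = (n%:R + 3) * gegen n - (n%:R + 1) * 'X * gegen n.+1.
Proof.
elim: n => [|n [IH1 IH2]].
  split; rewrite /= !derivE /w ?derivE; ring.
have E := gegenSS n.
split; first by rewrite IH2; apply: (lin_comb1 (c := 1) E); rewrite -!natr1; ring.
have nz : (n.+2%:R : {poly R}) != 0 by rewrite -polyC_natr polyC_eq0 pnatr_eq0.
apply: (mulfI nz).
have -> : n.+2%:R * (w * (gegen n.+2)^`()) = w * (n.+2%:R * gegen n.+2)^`().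
  by rewrite -polyC_natr derivM derivC; ring.
have e5 : (2 * n%:R + 5 : {poly R}) = (2 * n%:R + 5)%:P.
  by rewrite polyCD polyCM !polyC_natr.
have e3 : (n%:R + 3 : {poly R}) = (n%:R + 3)%:P by rewrite polyCD !polyC_natr.
rewrite E e5 {1}e3 !(derivB, derivM, derivD) !derivC ?derivX -e5 -e3.
apply: (lin_comb3 (c := (2 * n%:R + 5) * 'X) (c' := - (n%:R + 3)) (c'' := (n%:R + 2) * 'X) IH2 IH1
  E).
rewrite -!natr1 /w; ring.
Qed.

(** Differentiate the first ladder relation, multiply by [w] and eliminate [gegen n.+1] and its
    derivative by both relations. *)
Lemma gegen_eigen n : w * (gegen n)^`()^`() = 4 * 'X * (gegen n)^`() - n%:R * (n%:R + 3) * gegen n.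
Proof.
have [E1 E2] := gegen_deriv n.
apply: (mulfI w_neq0).
have e3 : (n%:R + 3 : {poly R}) = (n%:R + 3)%:P by rewrite polyCD !polyC_natr.
have e1 : (n%:R + 1 : {poly R}) = (n%:R + 1)%:P by rewrite polyCD !polyC_natr.
have := congr1 (@deriv R) E1.
rewrite [in RHS]e3 [in RHS]e1 !(deriv_w, derivB, derivM, derivD) !derivC ?derivX -e3 -e1 => D.
apply: (lin_comb3 (c := w) (c' := - (n%:R + 1)) (c'' := (n%:R + 1) * 'X) D E2 E1).
rewrite /w; ring.
Qed.

Lemma deriv_ode p b m : b^`() = 0 -> w * p^`()^`() = m%:R * 'X * p^`() - b * p ->
  w * p^`()^`()^`() = 2 * 'X * p^`()^`() + m%:R * p^`() + m%:R * 'X * p^`()^`() - b * p^`().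
Proof.
move=> b0 /(congr1 (@deriv R)).
rewrite -polyC_natr !(deriv_w, derivB, derivM) derivC derivX b0 => D.
by apply: (lin_comb1 (c := 1) D); rewrite polyC_natr; ring.
Qed.

(** The symmetric square of the operator [w p'' - 4 x p' + b p]: it kills the squares of the
    solutions of the latter. *)
Definition sqop (b f : {poly R}) :=
  w ^+ 2 * f^`()^`()^`() - 12 * 'X * w * f^`()^`() + (4 * b - 4) * w * f^`()
  + 24 * 'X ^+ 2 * f^`() - 12 * b * 'X * f.

Lemma sqopD b f g : sqop b (f + g) = sqop b f + sqop b g.
Proof. by rewrite /sqop !derivD; ring. Qed.

Lemma sqopZ b c f : sqop b (c%:P * f) = c%:P * sqop b f.
Proof. by rewrite /sqop !(mul_polyC, derivZ) -!mul_polyC; ring. Qed.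

Lemma sqop_sq p b : b^`() = 0 -> w * p^`()^`() = 4 * 'X * p^`() - b * p ->
  sqop b (p ^+ 2) = 0.
Proof.
move=> b0 O; have D := deriv_ode b0 O.
rewrite /sqop expr2 !(derivM, derivD).
apply: (lin_comb2 (c := 2 * w * p) (c' := 6 * w * p^`() - 12 * 'X * p) D O); ring.
Qed.

(** On an eigenfunction the ODE removes the second and third derivatives. The first-order operator
    that remains can be handled by the ladder relations. *)
Lemma sqop_eigen f b l : l^`() = 0 -> w * f^`()^`() = 4 * 'X * f^`() - l * f ->
  sqop b f = (4 * b - l) * (w * f^`()) - 6 * (2 * b - l) * ('X * f).
Proof.
move=> l0 O; have D := deriv_ode l0 O.
rewrite /sqop.
apply: (lin_comb2 (c := w) (c' := - 6 * 'X) D O); ring.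
Qed.

Lemma deriv_nat n : (n%:R : {poly R})^`() = 0.
Proof. by rewrite -polyC_natr derivC. Qed.

Lemma gegen_lam n : (n%:R * (n%:R + 3) : {poly R})^`() = 0.
Proof. by rewrite derivM derivD !deriv_nat; ring. Qed.

Lemma sqop_gegen0 b : sqop b (gegen 0) = - 4 * b * gegen 1.
Proof. by rewrite /sqop /= derivE !deriv0; ring. Qed.

(** Even indices go to the two neighbouring odd ones. On a sum of even-index terms, cancelling each
    odd index is therefore a first-order recurrence, that of [sqcoef]. *)
Lemma sqop_gegen n b : (2 * n%:R + 5) * sqop b (gegen n.+1) =
  (n%:R + 1) * (n%:R + 3) * (4 * b + 9 - (n%:R + 1) ^+ 2) * gegen n
  - (n%:R + 2) * (n%:R + 4) * (4 * b - (n%:R + 1) * (n%:R + 7)) * gegen n.+2.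
Proof.
have [_ E2] := gegen_deriv n; have E := gegenSS n.
rewrite (sqop_eigen _ (gegen_lam n.+1) (gegen_eigen n.+1)) E2.
set l := n.+1%:R * _.
apply: (lin_comb1 (c := (4 * b - l) * (n%:R + 1) + 6 * (2 * b - l)) E).
rewrite /l -!natr1; ring.
Qed.

Lemma gegen_coef n : (size (gegen n) <= n.+1)%N /\ 0 < (gegen n)`_n.
Proof.
suff: ((size (gegen n) <= n.+1)%N /\ 0 < (gegen n)`_n) /\
      ((size (gegen n.+1) <= n.+2)%N /\ 0 < (gegen n.+1)`_n.+1) by case.
elim: n => [|n [[S1 P1] [S2 P2]]].
  split; split.
  - by rewrite size_poly1.
  - by rewrite coef1 ltr01.
  - by rewrite size_Cmul ?size_polyX ?pnatr_eq0.
  - by rewrite coefCM coefX mulr1 ltr0n.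
split=> //; rewrite [gegen n.+2]/= -/(gegen n.+1); split.
  rewrite mul_polyC (leq_trans (size_scale_leq _ _)) //.
  rewrite (leq_trans (size_polyD _ _)) // size_polyN geq_max; apply/andP; split.
    rewrite -mulrA mul_polyC (leq_trans (size_scale_leq _ _)) //.
    have [->|nz] := eqVneq (gegen n.+1) 0; first by rewrite mulr0 size_poly0.
    by rewrite mulrC size_mulX.
  by rewrite mul_polyC (leq_trans (size_scale_leq _ _)) // (leq_trans S1) // ltnW.
rewrite coefCM coefB -mulrA coefCM coefXM /= coefCM [X in _ - _ * X]nth_default; last exact:
  leq_trans S1 _.
rewrite mulr0 subr0 !mulr_gt0 ?invr_gt0 ?ltr0n //.
by rewrite ltr_wpDl ?mulr_ge0 ?ler0n ?ltr0n.
Qed.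

Arguments gegen : simpl never.

(** The indicial polynomial of [sqop] at infinity: only the top-degree part of each term
    contributes. *)
Lemma sqop_coef (b : R) (f : {poly R}) i : (size f <= i.+1)%N ->
  (sqop b%:P f)`_i.+1 = - (i%:R + 3) * (4 * b - i%:R * (i%:R + 6)) * f`_i.
Proof.
move=> Sf.
have Z j : (i < j)%N -> f`_j = 0 by move=> ij; rewrite nth_default // (leq_trans Sf).
have -> : sqop b%:P f = f^`()^`()^`() - (2%:P * (f^`()^`()^`() * 'X^2)) + f^`()^`()^`() * 'X^4
   - 12%:P * (f^`()^`() * 'X^1) + 12%:P * (f^`()^`() * 'X^3)
   + (4 * b - 4)%:P * f^`() + (28 - 4 * b)%:P * (f^`() * 'X^2) - (12 * b)%:P * (f * 'X^1).
  by rewrite /sqop /w !(polyCB, polyCM); ring.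
rewrite !(coefD, coefN, coefCM, coefMXn, coef_deriv).
have Z2 := Z i.+2 (leqnSn _); have Z4 := Z i.+4 (leq_trans (leqnSn _) (leq_addl 2 _)).
(* Multiplication by ['X^4] shifts the index [i.+1] down by 4, so [i < 3] has to be treated
   apart. *)
by case: i Z2 Z4 {Z Sf} => [|[|[|i]]] Z2 Z4;
  rewrite ?(subSS, subn0) /= ?(subSS, subn0) !(Z2, Z4) ?mul0rn; ring.
Qed.

(** The indicial equation of [sqop] at infinity has no root below [2k]. *)
Lemma sqop_inj k (f : {poly R}) : (size f <= k.*2)%N ->
  sqop (k%:R * (k%:R + 3))%:P f = 0 -> f = 0.
Proof.
move=> Sf Lf; apply/eqP; apply: contraT => nz.
have sz : size f = (size f).-1.+1 by rewrite prednK // size_poly_gt0.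
have := sqop_coef (k%:R * (k%:R + 3)) (eq_leq sz).
rewrite Lf coef0 => /esym/eqP; rewrite -/(lead_coef f) !mulf_eq0 lead_coef_eq0 (negPf nz) orbF.
set i := (size f).-1; have {Sf} : (i < k.*2)%N by rewrite /i -sz.
move=> ik; rewrite oppr_eq0 (_ : 4 * _ - _ = (k.*2%:R - i%:R) * (k.*2%:R + i%:R + 6)); last first.
  by rewrite -addnn natrD; ring.
rewrite mulf_eq0 subr_eq0 eqr_nat (gtn_eqF ik).
have i0 : 0 <= (i%:R : R) := ler0n _ _; have k0 : 0 <= (k.*2%:R : R) := ler0n _ _.
by rewrite !gt_eqF //; lra.
Qed.

(** The recurrence that [sqop] imposes, via [sqop_gegen], on the coefficients on [gegen j.*2]. *)
Fixpoint sqcoef (b : R) (j : nat) : R :=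
  if j is j'.+1 then
    sqcoef b j' * ((j'.*2%:R + 1) * (j'.*2%:R + 3) * (2 * j'.*2%:R + 7) *
      (4 * b - j'.*2%:R * (j'.*2%:R + 6)))
    / ((2 * j'.*2%:R + 3) * (j'.*2%:R + 2) * (j'.*2%:R + 4) * (4 * b + 9 - (j'.*2%:R + 2) ^+ 2))
  else 1.

(** Here [4 b + 9 = (2 k + 3)^2], so that the last factors of denominator and numerator are
    differences of squares, [(2 k + 3)^2 - (2 j + 2)^2] and [(2 k + 3)^2 - (2 j + 3)^2], both
    positive for [j < k]. *)
Lemma sqcoefS k j : (j < k)%N -> let b := k%:R * (k%:R + 3) in
  0 < (2 * j.*2%:R + 3) * (j.*2%:R + 2) * (j.*2%:R + 4) * (4 * b + 9 - (j.*2%:R + 2) ^+ 2) :> R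
  /\ (0 < sqcoef b j -> 0 < sqcoef b j.+1).
Proof.
move=> jk b.
have J : 0 <= (j%:R : R) by exact: ler0n.
have [d kE] : exists d, k = (j + d.+1)%N.
  by exists (k - j.+1)%N; rewrite addnS -addSn subnKC.
have {kE} bE : b = (j%:R + d%:R + 1) * (j%:R + d%:R + 4).
  by rewrite /b kE addnS -natr1 natrD; ring.
have D : 0 <= (d%:R : R) by exact: ler0n.
have P : 0 < (2 * j.*2%:R + 3) * (j.*2%:R + 2) * (j.*2%:R + 4) *
  (4 * b + 9 - (j.*2%:R + 2) ^+ 2) :> R.
  rewrite (_ : 4 * b + 9 - _ = (2 * d%:R + 3) * (4 * j%:R + 2 * d%:R + 7)).
    by rewrite -addnn natrD !mulr_gt0 //; lra.
  by rewrite bE -addnn natrD; ring.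
split=> // s0; rewrite /= divr_gt0 // !mulr_gt0 //.
- by rewrite -addnn natrD; lra.
- by rewrite -addnn natrD; lra.
- by rewrite -addnn natrD; lra.
rewrite (_ : 4 * b - _ = (2 * d%:R + 2) * (4 * j%:R + 2 * d%:R + 8)); first by
  rewrite mulr_gt0 //; lra.
by rewrite bE -addnn natrD; ring.
Qed.

Lemma sqcoef_rec k j : (j < k)%N -> let b := k%:R * (k%:R + 3) in
  sqcoef b j.+1 * ((2 * j.*2%:R + 3) * (j.*2%:R + 2) * (j.*2%:R + 4) *
    (4 * b + 9 - (j.*2%:R + 2) ^+ 2))
  = sqcoef b j * ((j.*2%:R + 1) * (j.*2%:R + 3) * (2 * j.*2%:R + 7) *
    (4 * b - j.*2%:R * (j.*2%:R + 6))).
Proof. by move=> jk b; rewrite /= divfK // gt_eqF //; case: (sqcoefS jk). Qed.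

Arguments sqcoef : simpl never.

Lemma sqcoef_gt0 k j : (j <= k)%N -> 0 < sqcoef (k%:R * (k%:R + 3)) j.
Proof.
elim: j => [|j IH] jk; first exact: ltr01.
by apply: (sqcoefS jk).2; apply: IH; apply: ltnW.
Qed.

Definition sqsum b k : {poly R} := \sum_(j < k.+1) (sqcoef b j)%:P * gegen j.*2.

Lemma sqsumS b m : sqsum b m.+1 = sqsum b m + (sqcoef b m.+1)%:P * gegen m.+1.*2.
Proof. by rewrite /sqsum big_ord_recr. Qed.

(** The sum telescopes to one boundary term. Its factor [4 b - 2 m (2 m + 6)] vanishes at [m = k],
    so the full sum is killed by [sqop]. *)
Lemma sqop_sqsum k m : (m <= k)%N -> let b := k%:R * (k%:R + 3) in
  (2 * m.*2%:R + 3)%:P * sqop b%:P (sqsum b m) =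
  - (sqcoef b m * (m.*2%:R + 1) * (m.*2%:R + 3) * (4 * b - m.*2%:R * (m.*2%:R + 6)))%:P
  * gegen m.*2.+1.
Proof.
move=> mk b; elim: m mk => [|m IH] mk.
  have -> : sqsum b 0 = gegen 0 by rewrite /sqsum big_ord1 /= /sqcoef mul1r.
  rewrite sqop_gegen0 double0; change (sqcoef b 0) with (1 : R); ring.
have {IH} IH := IH (ltnW mk).
have nz : (2 * m.*2%:R + 3)%:P != 0 :> {poly R}.
  by rewrite polyC_eq0 -natrM -natrD pnatr_eq0 addnS.
apply: (mulfI nz).
rewrite sqsumS sqopD sqopZ doubleS.
have G := sqop_gegen m.*2.+1 b%:P.
have := congr1 (@polyC R) (sqcoef_rec mk); rewrite -/b.
move: (sqcoef b m.+1) (sqcoef b m) IH => s1 s0 IH C.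
move: (sqop _ _) (sqop _ _) IH G => o1 o2 IH G.
clear -IH C G; clearbody b.
apply: (lin_comb3 (c := (2 * m.*2%:R + 7)) (c' := (2 * m.*2%:R + 3) * s1%:P)
  (c'' := gegen m.*2.+1) IH G C).
ring.
Qed.

Lemma sqsum_coef b m : (forall j, (j <= m)%N -> 0 < sqcoef b j) ->
  (size (sqsum b m) <= m.*2.+1)%N /\ 0 < (sqsum b m)`_m.*2.
Proof.
move=> b0; have S j : (j <= m)%N -> (size (sqsum b j) <= j.*2.+1)%N.
  elim: j => [|j IH] jm.
    by rewrite /sqsum big_ord1 mul_polyC (leq_trans (size_scale_leq _ _)) // (gegen_coef 0).1.
  rewrite sqsumS (leq_trans (size_polyD _ _)) // geq_max (leq_trans (IH (ltnW jm))) ?ltnS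
    ?leq_double //=.
  by rewrite mul_polyC (leq_trans (size_scale_leq _ _)) // (gegen_coef _).1.
split; first exact: S.
case: m b0 S => [|m] b0 S.
  by rewrite /sqsum big_ord1 coefCM mulr_gt0 ?b0 // (gegen_coef 0).2.
rewrite sqsumS coefD nth_default; last exact: leq_trans (S m (leqnSn _)) (leqnSn _).
by rewrite add0r coefCM mulr_gt0 ?b0 // (gegen_coef _).2.
Qed.

(** Both [q ^+ 2] and [sqsum b k] have degree [2 k] and are killed by [sqop]. With [c] matching the
    leading coefficients, their difference has lower degree and [sqop_inj] applies. *)
Lemma sq_expand k (q : {poly R}) : let b := k%:R * (k%:R + 3) in
  size q = k.+1 -> w * q^`()^`() = 4 * 'X * q^`() - b%:P * q ->
  exists2 c, 0 < c & q ^+ 2 = c%:P * sqsum b k.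
Proof.
move=> b Sq O.
have [SV V0] := sqsum_coef (@sqcoef_gt0 k).
have qn0 : q != 0 by rewrite -size_poly_gt0 Sq.
have Sq2 : size (q ^+ 2) = k.*2.+1.
  by rewrite -[LHS]prednK ?size_exp ?Sq ?muln2 // size_poly_gt0 expf_neq0.
have q2 : (q ^+ 2)`_k.*2 = lead_coef q ^+ 2.
  by rewrite -lead_coef_exp /lead_coef Sq2.
pose c := lead_coef q ^+ 2 / (sqsum b k)`_k.*2.
have c0 : 0 < c by rewrite divr_gt0 // exprn_even_gt0 //= lead_coef_eq0.
exists c => //; apply/subr0_eq; apply: (@sqop_inj k).
  apply/leq_sizeP => j; rewrite leq_eqVlt => /orP [/eqP <-|kj].
    by rewrite coefB coefCM q2 /c divfK ?subrr // gt_eqF.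
  by rewrite coefB coefCM !nth_default ?mulr0 ?subrr ?Sq2 // (leq_trans SV).
have -> : - (c%:P * sqsum b k) = (- c)%:P * sqsum b k by rewrite polyCN mulNr.
rewrite sqopD sqopZ (sqop_sq _ O) ?derivC // add0r.
have nz : (2 * k.*2%:R + 3)%:P != 0 :> {poly R}.
  by rewrite polyC_eq0 -natrM -natrD pnatr_eq0 addnS.
apply: (mulfI nz).
rewrite mulrCA (sqop_sqsum (leqnn k)) (_ : 4 * _ - _ = 0) ?mulr0 ?oppr0 ?mul0r ?mulr0 //.
by rewrite -addnn natrD; ring.
Qed.

(** The Gegenbauer operator, symmetric for the weight [w]: [w * lap f] is the derivative of
    [w^2 f']. *)
Definition lap (f : {poly R}) : {poly R} := w * f^`()^`() - 4 * 'X * f^`().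

Lemma horner_w x : w.[x] = 1 - x ^+ 2.
Proof. by rewrite /w hornerD hornerN hornerXn hornerC. Qed.

(** The factor [w] vanishes at both ends, so the integrations by parts leave no boundary terms. *)
Lemma Int_deriv_w f : Int (w * f)^`() = 0.
Proof. by rewrite Int_deriv !hornerM !horner_w; ring. Qed.

Lemma lap_lin c d f g : c^`() = 0 -> d^`() = 0 -> lap (c * f + d * g) = c * lap f + d * lap g.
Proof. by move=> c0 d0; rewrite /lap !(derivD, derivM, c0, d0, mul0r, add0r); ring. Qed.

Lemma lap_gegen n : lap (gegen n) = - (n%:R * (n%:R + 3)) * gegen n.
Proof. by rewrite /lap gegen_eigen; ring. Qed.

(** Green's formula for [sqop] paired with the weight [w * gegen n.+1]: up to exact terms, its
    adjoint sends [gegen n.+1] to a combination of [gegen n] and [gegen n.+2]. *)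
Lemma moment_ident u a n : a^`() = 0 -> sqop a u = 0 ->
  w * u * ((n%:R + 3) ^+ 2 * (4 * a + 9 - (n%:R + 3) ^+ 2) * gegen n
     - (n%:R + 2) ^+ 2 * (4 * a + 9 - (n%:R + 2) ^+ 2) * gegen n.+2)
  = (w * (let g := (n%:R + 3) * (n%:R + 6) * gegen n - (n%:R - 1) * (n%:R + 2) * gegen n.+2 in
      (2 * n%:R + 5) * (w * gegen n.+1 * (lap u + 4 * a * u)) - w * (g * u^`() - g^`() * u)))^`().
Proof.
move=> a0 Lu; have [_ E2] := gegen_deriv n; have E := gegenSS n.
set g := (n%:R + 3) * (n%:R + 6) * _ - _.
have H1 : (2 * n%:R + 5) * (w * (gegen n.+1)^`() + 2 * 'X * gegen n.+1) = g.
  by rewrite E2 /g; apply: (lin_comb1 (c := n%:R - 1) E); ring.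
have H2 : (2 * n%:R + 5) * (w * (gegen n.+1)^`() - 'X * gegen n.+1) =
  (n%:R + 3) ^+ 2 * gegen n - (n%:R + 2) ^+ 2 * gegen n.+2.
  by rewrite E2; apply: (lin_comb1 (c := n%:R + 2) E); ring.
have H3 : lap g = - (n%:R + 3) * (n%:R + 6) * (n%:R * (n%:R + 3)) * gegen n
  + (n%:R - 1) * (n%:R + 2) * ((n%:R + 2) * (n%:R + 5)) * gegen n.+2.
  by rewrite /g -mulNr lap_lin ?lap_gegen; [ring|..];
    rewrite !(derivN, derivM, derivB, derivD, deriv_nat, deriv_nat 1); ring.
have c5 : (2 * n%:R + 5 : {poly R})^`() = 0 by rewrite derivD derivM !deriv_nat; ring.
have dlap : (lap u)^`() = w * u^`()^`()^`() - 6 * 'X * u^`()^`() - 4 * u^`().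
  by rewrite /lap !(deriv_w, derivB, derivM, derivX, deriv_nat); ring.
clearbody g.
rewrite !(deriv_w, derivB, derivM) c5 derivD !derivM a0 dlap !deriv_nat.
rewrite /sqop in Lu; rewrite /lap in H3 *.
move: Lu H1 H2 H3; move: (gegen n) (gegen n.+1) (gegen n.+2) => e0 e1 e2 Lu H1 H2 H3.
rewrite [LHS](_ : _ = w * u * (- (n%:R + 3) * (n%:R + 6) * (n%:R * (n%:R + 3)) * e0
  + (n%:R - 1) * (n%:R + 2) * ((n%:R + 2) * (n%:R + 5)) * e2) +
  4 * a * w * u * ((n%:R + 3) ^+ 2 * e0 - (n%:R + 2) ^+ 2 * e2)); last by ring.
rewrite -H3 -H2.
apply: (lin_comb2 (c := - (2 * n%:R + 5) * w * e1) (c' := - w * (w * u^`()^`() - 4 * 'X * u^`()))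
  Lu H1).
rewrite /w; ring.
Qed.

Lemma moment_rec u a n : sqop a%:P u = 0 ->
  (n%:R + 2) ^+ 2 * (4 * a + 9 - (n%:R + 2) ^+ 2) * Int (w * u * gegen n.+2) =
  (n%:R + 3) ^+ 2 * (4 * a + 9 - (n%:R + 3) ^+ 2) * Int (w * u * gegen n).
Proof.
move=> Lu; have := congr1 (@Int R) (moment_ident n (derivC a) Lu).
rewrite Int_deriv_w => H; apply/esym/subr0_eq; rewrite -{}H.
have -> : forall x y z t : R, x * y - z * t = x * y + (- z) * t by move=> *; ring.
rewrite -!IntZ -IntD; congr Int; ring.
Qed.

Lemma Int_sqsum u b k A B :
  Int (w * u * (A%:P * sqsum b k + B%:P * lap (sqsum b k))) =
  \sum_(j < k.+1) (A - B * (j.*2%:R * (j.*2%:R + 3))) * (sqcoef b j * Int (w * u * gegen j.*2)).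
Proof.
have lapE j : Int (w * u * (A%:P * ((sqcoef b j)%:P * gegen j.*2)
    + B%:P * lap ((sqcoef b j)%:P * gegen j.*2))) =
   (A - B * (j.*2%:R * (j.*2%:R + 3))) * (sqcoef b j * Int (w * u * gegen j.*2)).
  rewrite -!IntZ; congr Int.
  have -> : lap ((sqcoef b j)%:P * gegen j.*2) = (sqcoef b j)%:P * lap (gegen j.*2).
    by rewrite /lap !(mul_polyC, derivZ) -!mul_polyC; ring.
  by rewrite lap_gegen; ring.
elim: k => [|k IH]; first by rewrite /sqsum !big_ord1 lapE.
rewrite sqsumS big_ord_recr [in RHS]/= -IH -lapE -IntD; congr Int.
rewrite /lap !derivD; ring.
Qed.

(** Up to an exact derivative, the squared Wronskian is traded for an expression in [p ^+ 2] and
    [q ^+ 2] alone, to which the expansion of [q ^+ 2] applies. *)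
Lemma bracket_ident p q a b : a^`() = 0 -> b^`() = 0 ->
  w * p^`()^`() = 4 * 'X * p^`() - a * p -> w * q^`()^`() = 4 * 'X * q^`() - b * q ->
  2 * (a * w ^+ 2 * (p * q^`() - p^`() * q) ^+ 2 - (a - b) ^+ 2 * w * p ^+ 2 * q ^+ 2) =
  w * p ^+ 2 * ((6 * a * b - 2 * b ^+ 2) * q ^+ 2 + 3 * a * lap (q ^+ 2))
  + (w * (a * w * ((p ^+ 2)^`() * q ^+ 2 - 2 * p ^+ 2 * (q ^+ 2)^`())))^`().
Proof.
move=> a0 b0 Op Oq; rewrite /lap !expr2 !(deriv_w, deriv_nat, derivB, derivM, derivD) a0.
apply: (lin_comb2 (c := - 2 * a * w * p * q ^+ 2) (c' := - 2 * a * w * p ^+ 2 * q) Op Oq).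
rewrite /w; ring.
Qed.

Lemma spectral_sum n k p q : let a := n%:R * (n%:R + 3) in let b := k%:R * (k%:R + 3) in
  w * p^`()^`() = 4 * 'X * p^`() - a%:P * p -> w * q^`()^`() = 4 * 'X * q^`() - b%:P * q ->
  size q = k.+1 ->
  exists2 c, 0 < c &
  2 * Int (a%:P * w ^+ 2 * (p * q^`() - p^`() * q) ^+ 2 - (a%:P - b%:P) ^+ 2 * w * p ^+ 2 *
    q ^+ 2) =
  c * \sum_(j < k.+1) (6 * a * b - 2 * b ^+ 2 - 3 * a * (j.*2%:R * (j.*2%:R + 3)))
     * (sqcoef b j * Int (w * p ^+ 2 * gegen j.*2)).
Proof.
move=> a b Op Oq Sq; have [c c0 E] := sq_expand Sq Oq.
exists c => //; rewrite -Int_sqsum -!IntZ.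
have -> : 2%:P = 2 :> {poly R} by rewrite polyC_natr.
rewrite (bracket_ident _ _ Op Oq) ?derivC // E IntD Int_deriv_w addr0; congr Int.
have -> : lap (c%:P * sqsum b k) = c%:P * lap (sqsum b k).
  by rewrite /lap !(mul_polyC, derivZ) -!mul_polyC; ring.
ring.
Qed.

End Gegenbauer.

(** * Derivatives of the polynomials (x^2 - 1)^l *)

Section Rodrigues.
Variable (R : realFieldType).

Definition rodp l : {poly R} := ('X ^+ 2 - 1) ^+ l.

(** Differentiate the first-order equation [(1 - x^2) y' = - 2 l x y] of [y = (x^2 - 1)^l]
    repeatedly. At [n = l] this is Legendre's equation. *)
Lemma rodp_ode l n : (1 - 'X ^+ 2) * (rodp l)^`(n.+2) =
  2 * (n%:R + 1 - l%:R) * 'X * (rodp l)^`(n.+1) + (n%:R + 1) * (n%:R - 2 * l%:R) * (rodp l)^`(n).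
Proof.
have dX : ('X ^+ 2 - 1 : {poly R})^`() = 2 * 'X.
  by rewrite !derivE; ring.
elim: n => [|n IH].
  have E : (1 - 'X ^+ 2) * (rodp l)^`() = - 2 * l%:R * 'X * rodp l.
    rewrite /rodp; case: l => [|l]; first by rewrite expr0 -polyC1 derivC; ring.
    by rewrite deriv_exp dX /= [_ ^+ l.+1]exprS; ring.
  rewrite derivnS derivn1 derivn0.
  have := congr1 (@deriv R) E.
  have -> : (- 2 * l%:R * 'X * rodp l)^`() = - 2 * l%:R * (rodp l + 'X * (rodp l)^`()).
    have -> : - 2 * l%:R * 'X * rodp l = (- 2 * l%:R)%:P * ('X * rodp l) by ring.
    by rewrite !derivM derivC derivX; ring.
  rewrite derivM (_ : (1 - 'X ^+ 2)^`() = - 2 * 'X); last by rewrite -opprB derivN dX; ring.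
  by move=> D; apply: (lin_comb1 (c := 1) D); ring.
have := congr1 (@deriv R) IH.
have -> : 2 * (n%:R + 1 - l%:R) * 'X * (rodp l)^`(n.+1) + (n%:R + 1) * (n%:R - 2 * l%:R) *
  (rodp l)^`(n)
  = (2 * (n%:R + 1 - l%:R))%:P * ('X * (rodp l)^`(n.+1)) + ((n%:R + 1) * (n%:R - 2 * l%:R))%:P *
    (rodp l)^`(n)
  by ring.
rewrite derivD !derivM !derivC derivX -!derivnS (_ : (1 - 'X ^+ 2)^`() = - 2 * 'X); last first.
  by rewrite -opprB derivN dX; ring.
by move=> D; apply: (lin_comb1 (c := 1) D); ring.
Qed.

Lemma size_rodp l : size (rodp l) = l.*2.+1.
Proof.
have s2 : size ('X ^+ 2 - 1 : {poly R}) = 3 by rewrite -polyC1 size_XnsubC.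
have nz : ('X ^+ 2 - 1 : {poly R}) != 0 by rewrite -size_poly_gt0 s2.
by rewrite -[LHS]prednK ?size_exp ?s2 ?mul2n // size_poly_gt0 expf_neq0.
Qed.

Lemma size_rodp_derivn l n : (n <= l.*2)%N -> size (rodp l)^`(n) = (l.*2 - n).+1.
Proof.
elim: n => [|n IH] nl; first by rewrite derivn0 size_rodp subn0.
have := IH (ltnW nl); rewrite derivnS => Sn.
have -> : (l.*2 - n.+1).+1 = (l.*2 - n)%N by rewrite subnSK.
apply/eqP; rewrite eqn_leq; apply/andP; split.
  by have := lt_size_deriv (_ : (rodp l)^`(n) != 0); rewrite -size_poly_gt0 Sn => /(_ isT).
rewrite -(subnSK nl); apply: contraT; rewrite -leqNgt => /leq_sizeP /(_ _ (leqnn _)).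
rewrite coef_deriv => /eqP; rewrite mulrn_eq0 /= subnSK // => /eqP.
have -> : ((rodp l)^`(n))`_(l.*2 - n) = lead_coef (rodp l)^`(n) by rewrite /lead_coef Sn.
by move/eqP; rewrite lead_coef_eq0 -size_poly_eq0 Sn.
Qed.

Lemma rodp_gegen_ode n : let p := (rodp n.+1)^`(n.+2) in
  (1 - 'X ^+ 2) * p^`()^`() = 4 * 'X * p^`() - (n%:R * (n%:R + 3))%:P * p.
Proof. by move=> p; rewrite /p -!derivnS rodp_ode; ring. Qed.

End Rodrigues.

(** * From formal polynomials to real functions and Riemann integrals *)

Local Notation RR := Rdefinitions.R.

Lemma is_derive_horner (p : {poly RR}) (x : RR) : is_derive (fun t : RR => p.[t]) x (p^`()).[x].
Proof.
elim/poly_ind: p => [|p c /is_derive_Reals IH]; apply/is_derive_Reals.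
  rewrite deriv0 horner0; apply: (derivable_pt_lim_ext (fct_cte 0%R)) => [t|].
    by rewrite horner0.
  exact: derivable_pt_lim_const.
apply: (derivable_pt_lim_ext (plus_fct (mult_fct (fun t => p.[t]) id) (fct_cte c))) => [t|].
  by rewrite hornerMXaddC.
have -> : (p * 'X + c%:P)^`().[x] = (p^`().[x] * id x + p.[x] * 1 + 0)%R.
  by rewrite derivD derivC addr0 derivM derivX mulr1 hornerD hornerMX addr0 mulr1.
apply: derivable_pt_lim_plus; last exact: derivable_pt_lim_const.
by apply: derivable_pt_lim_mult => //; exact: derivable_pt_lim_id.
Qed.

Lemma Derive_n_horner (p : {poly RR}) n (x : RR) : Derive_n (fun t : RR => p.[t]) n x =
  (p^`(n)).[x].
Proof.
elim: n x => [|n IH] x; first by rewrite derivn0.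
transitivity (Derive (fun t => (p^`(n)).[t]) x); first exact: Derive_ext.
rewrite derivnS; exact/is_derive_unique/is_derive_horner.
Qed.

Lemma rodE l n x : rod l n x = ((rodp RR l)^`(n)).[x].
Proof.
rewrite -Derive_n_horner; apply: Derive_n_ext => t.
by rewrite /rodp horner_exp hornerD hornerN hornerXn hornerC !RpowE.
Qed.

Lemma is_RInt_horner (p : {poly RR}) : is_RInt (fun t => p.[t]) (-1)%R 1%R (Int p).
Proof.
rewrite /Int; apply: (is_RInt_derive (fun t => (prim p).[t])) => x _.
  by rewrite -{2}[p]deriv_prim; exact: is_derive_horner.
apply: ex_derive_continuous; exists (p^`()).[x]; exact: is_derive_horner.
Qed.

(** The primitive is nondecreasing by the mean value theorem. If its end values agreed, it would be
    constant on [0, 1], hence a constant polynomial, and [p] would vanish. *)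
Lemma Int_gt0 (p : {poly RR}) : p != 0 -> (forall x, -1 <= x <= 1 -> 0 <= p.[x]) -> 0 < Int p.
Proof.
move=> p0 p_ge0.
have mono x y : -1 <= x -> x <= y -> y <= 1 -> (prim p).[x] <= (prim p).[y].
  move=> x1 xy y1.
  have [||c [[/RleP c1 /RleP c2] E]] := MVT_gen (fun t => (prim p).[t]) x y (fun t => p.[t]).
  - by move=> t _; rewrite -{2}[p]deriv_prim; exact: is_derive_horner.
  - move=> t _; apply/continuity_pt_filterlim/ex_derive_continuous.
    by exists ((prim p)^`()).[t]; exact: is_derive_horner.
  move: c1 c2; rewrite Rmin_left ?Rmax_right; [|exact/RleP..] => c1 c2.
  rewrite -subr_ge0 (_ : _ - _ = p.[c] * (y - x)) ?mulr_ge0 ?subr_ge0 //.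
  by apply: p_ge0; rewrite (le_trans x1 c1) (le_trans c2 y1).
rewrite /Int subr_gt0 lt_neqAle mono ?lexx //; last by lra.
rewrite andbT; apply/eqP => E.
have cst x : 0 <= x <= 1 -> root (prim p - (prim p).[1]%:P) x.
  move=> /andP [x0 x1]; rewrite rootE hornerD hornerN hornerC subr_eq0 eq_le mono //=; last by lra.
  by rewrite -E mono //; lra.
have Q0 : prim p - (prim p).[1]%:P != 0.
  apply: contraNneq p0 => /(congr1 (@deriv _)); rewrite derivB derivC deriv_prim deriv0 subr0.
  by move=> ->.
(* The points 1, 1/2, 1/3, ...: as many distinct roots as the size of the polynomial, one more than
   its degree allows. *)
pose rs : seq RR := [seq (i.+1%:R)^-1 | i <- iota 0 (size (prim p - (prim p).[1]%:P))].
have := @max_poly_roots _ _ rs Q0; rewrite size_map size_iota ltnn => H.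
suff : false by []; apply: H.
  apply/allP => _ /mapP [i _ ->]; apply: cst.
  by rewrite invr_ge0 ler0n invf_le1 ?ltr0n ?ler1n.
rewrite map_inj_uniq ?iota_uniq // => i j /invr_inj /eqP; rewrite eqr_nat => /eqP [].
by [].
Qed.

Section RodReal.
Local Open Scope R_scope.

Lemma is_derive_rod l n (x : RR) : is_derive (rod l n) x (rod l (S n) x).
Proof.
rewrite rodE derivnS; apply: is_derive_ext (is_derive_horner _ _).
by move=> t; rewrite rodE.
Qed.

Lemma rod_ode l n (x : RR) : (1 - x ^ 2) * rod l (S (S n)) x =
  2 * (INR n + 1 - INR l) * x * rod l (S n) x + (INR n + 1) * (INR n - 2 * INR l) * rod l n x.
Proof.
rewrite !rodE; have := congr1 (fun p : {poly RR} => p.[x]) (rodp_ode RR l n).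
rewrite !(hornerD, hornerM, hornerN, hornerXn, hornerX) -!polyC_natr -polyC1 !hornerC => H.
by rewrite !RealsE.
Qed.

(** Hence the associated Legendre function with order equal to degree is a multiple of
    [sqrt (1 - x^2) ^ l]. *)
Lemma rod_diag l : exists2 c, c <> 0 & forall x, rod l (l + l)%coq_nat x = c.
Proof.
have S1 : size ((rodp RR l)^`(l + l)) = 1%N by rewrite size_rodp_derivn addnn ?subnn.
exists ((rodp RR l)^`(l + l))`_0.
  apply/eqP; rewrite -[_`_0]/(((rodp RR l)^`(l + l))`_(1.-1)) -S1 -/(lead_coef _).
  by rewrite lead_coef_eq0 -size_poly_gt0 S1.
by move=> x; rewrite rodE plusE [X in X.[x]]size1_polyC ?S1 // hornerC.
Qed.

Lemma RInt_horner f (p : {poly RR}) : (forall x, f x = p.[x]%R) -> RInt f (-1) 1 = Int p.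
Proof.
move=> fp; transitivity (RInt (fun x => p.[x]%R) (-1) 1); first exact: RInt_ext.
exact/is_RInt_unique/is_RInt_horner.
Qed.

Lemma RInt_rod_gt0 a l n : (n <= 2 * l)%coq_nat ->
  0 < RInt (fun x => (1 - x ^ 2) ^ a * rod l n x ^ 2) (-1) 1.
Proof.
move=> /ssrnat.leP; rewrite mul2n => nl.
set p : {poly RR} := ((1 - 'X ^+ 2) ^+ a * (rodp RR l)^`(n) ^+ 2)%R.
have pE x : p.[x]%R = ((1 - x ^+ 2) ^+ a * rod l n x ^+ 2)%R.
  by rewrite /p hornerM !horner_exp hornerD hornerN hornerXn hornerC rodE.
have -> : RInt (fun x => (1 - x ^ 2) ^ a * rod l n x ^ 2) (-1) 1 = Int p.
  by apply: RInt_horner => x; rewrite pE !RealsE.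
apply/RltP/Int_gt0.
  rewrite mulf_neq0 ?expf_neq0 ?w_neq0 // -size_poly_gt0 size_rodp_derivn //.
move=> x x1; rewrite pE mulr_ge0 ?sqr_ge0 // exprn_ge0 //; nra.
Qed.

Lemma RInt_bracket_rod_gt0 (n k : nat) : (1 <= k)%coq_nat /\ (k < n)%coq_nat ->
  let p := rod (S n) (S (S n)) in let p' := rod (S n) (S (S (S n))) in
  let q := rod (S k) (S (S k)) in let q' := rod (S k) (S (S (S k))) in
  let a := INR n * (INR n + 3) in let b := INR k * (INR k + 3) in
  0 < RInt (fun x => a * (1 - x ^ 2) ^ 2 * (p x * q' x - p' x * q x) ^ 2
     - (a - b) ^ 2 * (1 - x ^ 2) * p x ^ 2 * q x ^ 2) (-1) 1.
Proof.
move=> [k1 kn] p p' q q' a b; have {}kn : (k < n)%N by apply/ssrnat.ltP.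
pose P := (rodp RR n.+1)^`(n.+2); pose Q := (rodp RR k.+1)^`(k.+2).
have SQ : size Q = k.+1.
  by rewrite size_rodp_derivn doubleS ?subSS -addnn ?addnK // !ltnS leq_addr.
have [c c0] := spectral_sum (rodp_gegen_ode RR n) (rodp_gegen_ode RR k) SQ.
set A := (n%:R * _)%R; set B := (k%:R * _)%R; rewrite -/P -/Q.
set W := (1 - 'X^2)%R : {poly RR}.
set I : {poly RR} := (X in (2 * Int X)%R) => E.
have -> : RInt (fun x => a * (1 - x ^ 2) ^ 2 * (p x * q' x - p' x * q x) ^ 2
     - (a - b) ^ 2 * (1 - x ^ 2) * p x ^ 2 * q x ^ 2) (-1) 1 = Int I.
  apply: RInt_horner => x.
  rewrite /I /W !(hornerD, hornerM, hornerN, hornerXn, hornerX, horner_exp, hornerC).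
  by rewrite /p /q /p' /q' !rodE /a /b !RealsE.
apply/RltP.
pose M j := Int (W * P ^+ 2 * gegen RR j)%R.
pose T j : RR := (sqcoef B j * M j.*2)%R.
have OP : sqop A%:P (P ^+ 2) = 0%R by apply: sqop_sq (rodp_gegen_ode RR n); rewrite derivC.
have Mrec j : ((j%:R + 2) ^+ 2 * (4 * A + 9 - (j%:R + 2) ^+ 2) * M j.+2 =
  (j%:R + 3) ^+ 2 * (4 * A + 9 - (j%:R + 3) ^+ 2) * M j)%R by exact: moment_rec.
(* Induction from [gegen 0 = 1]. As [j < k < n], both [(2 j + 2)^2] and [(2 j + 3)^2] stay below
   [4 A + 9 = (2 n + 3)^2]. *)
have M0 j : (j <= k)%N -> (0 < M j.*2)%R.
  elim: j => [|j IH] jk.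
    rewrite /M double0 mulr1; apply: Int_gt0.
      by rewrite mulf_neq0 ?w_neq0 ?expf_neq0 // -size_poly_gt0 size_rodp_derivn // -addnn addSn
        addnS !ltnS leq_addr.
    move=> x x1; rewrite hornerM horner_exp horner_w mulr_ge0 ?sqr_ge0 //; nra.
  have := IH (ltnW jk); have := Mrec j.*2.
  have [d nE] : exists d, n = (j + d + 2)%N.
    by exists (n - j - 2)%N; rewrite addnAC -subnDA subnKC // addn2 (leq_trans _ kn).
  have J : (0 <= (j%:R : RR))%R by exact: ler0n.
  have D : (0 <= (d%:R : RR))%R by exact: ler0n.
  have -> : (4 * A + 9 - (j.*2%:R + 2) ^+ 2 = (2 * d%:R + 5) * (4 * j%:R + 2 * d%:R + 9))%R.
    by rewrite /A nE -addnn !natrD; ring.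
  have -> : (4 * A + 9 - (j.*2%:R + 3) ^+ 2 = (2 * d%:R + 4) * (4 * j%:R + 2 * d%:R + 10))%R.
    by rewrite /A nE -addnn !natrD; ring.
  rewrite doubleS -addnn natrD => R1 m0.
  have c1 : (0 < (j%:R + j%:R + 2) ^+ 2 * ((2 * d%:R + 5) * (4 * j%:R + 2 * d%:R + 9)) :> RR)%R.
    by rewrite !mulr_gt0 ?exprn_gt0 //; lra.
  rewrite -(pmulr_rgt0 _ c1) R1 !mulr_gt0 ?exprn_gt0 //; lra.
have T0 j : (j <= k)%coq_nat -> 0 < T j.
  by move=> /ssrnat.leP jk; apply/RltP; rewrite mulr_gt0 ?M0 // sqcoef_gt0.
have : 0 < sum_f_R0 (fun j => gap (INR n) (INR k) (INR j) * T j) k.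
  apply: gap_sum_gt0 (conj k1 (elimT ssrnat.ltP kn)) T0 _ => j /ssrnat.ltP jk N; have :=
    Mrec j.*2; have := sqcoef_rec RR jk; rewrite /T doubleS.
  rewrite -/B /N !RealsE -[j.*2]addnn natrD.
  move: (sqcoef B j) (sqcoef B j.+1) (M (j + j)%N) (M (j + j).+2) => s0 s1 m0 m1 E1 E2.
  (* The recurrence of [T] is the product of those of [sqcoef B] and [M]. *)
  apply: (lin_comb2 (c := ((2 * j%:R + 2) ^+ 2 * ((2 * n%:R + 3) ^+ 2 - (2 * j%:R + 2) ^+ 2) *
    m1)%R)
    (c' := (s0 * ((2 * j%:R + 1) * (2 * j%:R + 3) * (4 * j%:R + 7) *
      ((2 * k%:R + 3) ^+ 2 - (2 * j%:R + 3) ^+ 2)))%R) E1 E2).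
  rewrite /A /B /=; ring.
move/RltP => H; rewrite -(pmulr_rgt0 _ (ltr0Sn RR 1)) E mulr_gt0 //.
move: H; congr (0 < _)%R; rewrite RealsE big_mkord; apply: eq_bigr => j _.
by rewrite /gap /T !RealsE -/(M _) -addnn natrD /A /B /=; ring.
Qed.
End RodReal.

End Polynomials.
Import Polynomials.

(** * Functions on the sphere *)

Definition harm (c : C) (F : R -> R) (m : R) : cfun := fun lam mu =>
  (c * RtoC (F mu) * (cos (m * lam), sin (m * lam)))%C.

Definition eq_chart (f g : cfun) : Prop :=
  forall lam mu, in_chart lam mu -> f lam mu = g lam mu.

Lemma locally_Ioo (a b x : R) (P : R -> Prop) :
  a < x < b -> (forall t, a < t < b -> P t) -> locally x P.
Proof.
intros Hx HP.
assert (He : 0 < Rmin (x - a) (b - x)) by (apply Rmin_pos; lra).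
exists (mkposreal _ He). intros t Ht.
unfold ball in Ht; simpl in Ht; unfold AbsRing_ball, abs, minus, plus, opp in Ht; simpl in Ht.
apply HP. apply Rabs_def2 in Ht.
generalize (Rmin_l (x - a) (b - x)) (Rmin_r (x - a) (b - x)); lra.
Qed.

Lemma DeriveC_ext_Ioo (a b x : R) (f g : R -> C) :
  a < x < b -> (forall t, a < t < b -> f t = g t) -> DeriveC f x = DeriveC g x.
Proof.
intros Hx H. unfold DeriveC.
f_equal; apply Derive_ext_loc, (locally_Ioo a b); auto; intros t Ht; rewrite H; auto.
Qed.

Lemma eq_chart_d_lam f g : eq_chart f g -> eq_chart (d_lam f) (d_lam g).
Proof.
intros H lam mu [Hl Hm]. apply (DeriveC_ext_Ioo 0 (2 * PI)); auto.
intros t Ht; apply H; split; auto.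
Qed.

Lemma eq_chart_d_mu f g : eq_chart f g -> eq_chart (d_mu f) (d_mu g).
Proof.
intros H lam mu [Hl Hm]. apply (DeriveC_ext_Ioo (-1) 1); auto.
intros t Ht; apply H; split; auto.
Qed.

Lemma eq_chart_trans f g h : eq_chart f g -> eq_chart g h -> eq_chart f h.
Proof. intros H1 H2 lam mu Hc; rewrite H1, H2; auto. Qed.

(** Weaker than [eq_chart], because [stream] recovers a function only up to an additive constant. *)
Definition eq_grad (f g : cfun) : Prop :=
  eq_chart (d_lam f) (d_lam g) /\ eq_chart (d_mu f) (d_mu g).

Lemma eq_chart_grad f g : eq_chart f g -> eq_grad f g.
Proof. intros H; split; [apply eq_chart_d_lam|apply eq_chart_d_mu]; auto. Qed.

Lemma eq_grad_bracket f f' g g' :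
  eq_grad f f' -> eq_grad g g' -> eq_chart (bracket f g) (bracket f' g').
Proof.
intros [H1 H2] [H3 H4] lam mu Hc. unfold bracket.
rewrite (H1 _ _ Hc), (H2 _ _ Hc), (H3 _ _ Hc), (H4 _ _ Hc); reflexivity.
Qed.

Lemma eq_grad_laplacian f g : eq_grad f g -> eq_chart (laplacian f) (laplacian g).
Proof.
intros [H1 H2] lam mu Hc. unfold laplacian. f_equal.
- apply (eq_chart_d_mu (fun l t => (RtoC (1 - t ^ 2) * d_mu f l t)%C)
    (fun l t => (RtoC (1 - t ^ 2) * d_mu g l t)%C)); auto.
  intros l t Hlt. rewrite (H2 _ _ Hlt); reflexivity.
- f_equal. apply eq_chart_d_lam; auto.
Qed.

Lemma DeriveC_unique (h : R -> C) x a b :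
  is_derive (fun t => Re (h t)) x a -> is_derive (fun t => Im (h t)) x b -> DeriveC h x = (a, b).
Proof. intros Ha Hb. apply injective_projections; apply is_derive_unique; auto. Qed.

Lemma is_derive_lam_harm c F m lam mu :
  let z := harm (c * Ci * RtoC m)%C F m lam mu in
  is_derive (fun t => Re (harm c F m t mu)) lam (Re z) /\
  is_derive (fun t => Im (harm c F m t mu)) lam (Im z).
Proof. destruct c as [c1 c2]; split; unfold harm; simpl; auto_derive; auto; ring. Qed.

Lemma is_derive_mu_harm c F F1 m lam mu : is_derive F mu (F1 mu) ->
  let z := harm c F1 m lam mu in
  is_derive (fun t => Re (harm c F m lam t)) mu (Re z) /\
  is_derive (fun t => Im (harm c F m lam t)) mu (Im z).
Proof.
intros H; destruct c as [c1 c2]; split; unfold harm; simpl; auto_derive.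
1, 3 : repeat split; exists (F1 mu); exact H.
all : replace (Derive (fun x => F x) mu) with (F1 mu) by
  (symmetry; apply is_derive_unique; exact H); ring.
Qed.

Lemma d_lam_harm c F m lam mu :
  d_lam (harm c F m) lam mu = harm (c * Ci * RtoC m)%C F m lam mu.
Proof.
destruct (is_derive_lam_harm c F m lam mu) as [H1 H2].
rewrite (surjective_pairing (harm _ F m lam mu)). exact (DeriveC_unique _ _ _ _ H1 H2).
Qed.

Lemma d_mu_harm c F F1 m lam mu : is_derive F mu (F1 mu) ->
  d_mu (harm c F m) lam mu = harm c F1 m lam mu.
Proof.
intros H; destruct (is_derive_mu_harm c F F1 m lam mu H) as [H1 H2].
rewrite (surjective_pairing (harm _ F1 m lam mu)). exact (DeriveC_unique _ _ _ _ H1 H2).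
Qed.

(** Restricted to the open interval, as odd powers of [sqrt (1 - x^2)] enter, and derivatives with
    denominator [1 - x^2]. *)
Definition derive_Ioo (F F1 : R -> R) : Prop := forall x, -1 < x < 1 -> is_derive F x (F1 x).

Lemma bracket_harm c d F F1 G G1 m n : derive_Ioo F F1 -> derive_Ioo G G1 ->
  eq_chart (bracket (harm c F m) (harm d G n))
    (harm (c * d * Ci)%C (fun x => m * F x * G1 x - n * F1 x * G x) (m + n)).
Proof.
intros HF HG lam mu [Hl Hm]. unfold bracket.
rewrite !d_lam_harm, (d_mu_harm c F F1), (d_mu_harm d G G1) by (apply HF || apply HG; auto).
unfold harm. rewrite Rmult_plus_distr_r, cos_plus, sin_plus.
destruct c, d; apply injective_projections; simpl; ring.
Qed.

Lemma laplacian_harm c F F1 G m : derive_Ioo F F1 ->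
  derive_Ioo (fun x => (1 - x ^ 2) * F1 x) G ->
  eq_chart (laplacian (harm c F m)) (harm c (fun x => G x - m ^ 2 / (1 - x ^ 2) * F x) m).
Proof.
intros HF HG lam mu Hc. unfold laplacian.
assert (Emu : eq_chart (fun l t => (RtoC (1 - t ^ 2) * d_mu (harm c F m) l t)%C)
    (harm c (fun x => (1 - x ^ 2) * F1 x) m)).
{ intros l t [_ Ht]. rewrite (d_mu_harm _ _ F1) by (apply HF; auto). unfold harm.
  destruct c; apply injective_projections; simpl; ring. }
assert (Elam : eq_chart (d_lam (harm c F m)) (harm (c * Ci * RtoC m)%C F m)).
{ intros l t _. apply d_lam_harm. }
rewrite (eq_chart_d_mu _ _ Emu lam mu Hc), (eq_chart_d_lam _ _ Elam lam mu Hc).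
rewrite (d_mu_harm _ _ G) by (apply HG, Hc).
rewrite d_lam_harm. unfold harm, Rdiv.
destruct c; apply injective_projections; simpl; ring.
Qed.

Lemma ex_DeriveC_lam_harm c F m lam mu : ex_DeriveC (fun t => harm c F m t mu) lam.
Proof. destruct (is_derive_lam_harm c F m lam mu); split; eexists; eauto. Qed.

Lemma ex_DeriveC_mu_harm c F F1 m lam mu : is_derive F mu (F1 mu) ->
  ex_DeriveC (fun t => harm c F m lam t) mu.
Proof. intros H; destruct (is_derive_mu_harm c F F1 m lam mu H); split; eexists; eauto. Qed.

Lemma Copp_involutive (z : C) : (- - z)%C = z.
Proof. ring. Qed.

(** The harmonic itself witnesses that a stream function exists, so the one chosen by [epsilon]
    satisfies [stream_of], which fixes its gradient. *)
Lemma eq_grad_stream c F F1 m : derive_Ioo F F1 ->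
  eq_grad (stream (grad_perp (harm c F m))) (harm c F m).
Proof.
intros HF.
assert (H : stream_of (grad_perp (harm c F m)) (stream (grad_perp (harm c F m)))).
{ unfold stream. apply epsilon_spec. exists (harm c F m). intros lam mu [Hl Hm].
  split; [apply ex_DeriveC_lam_harm|split; [apply (ex_DeriveC_mu_harm c F F1), HF;
    exact Hm|reflexivity]]. }
split; intros lam mu Hc; destruct (H lam mu Hc) as (_ & _ & E);
  [exact (f_equal snd E)|apply (f_equal fst) in E; simpl in E].
rewrite <- (Copp_involutive (d_mu (stream _) lam mu)), E; apply Copp_involutive.
Qed.

Lemma RInt_RtoC c phi a b : ex_RInt phi a b ->
  RInt (V := C_R_CompleteNormedModule) (fun x => (c * RtoC (phi x))%C) a b
  = (c * RtoC (RInt phi a b))%C.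
Proof.
intros H. apply (RInt_correct (V := R_CompleteNormedModule)) in H. destruct c as [c1 c2].
apply is_RInt_unique.
replace ((c1, c2) * RtoC (RInt phi a b))%C with (scal c1 (RInt phi a b), scal c2 (RInt phi a b))
  by (apply injective_projections; unfold scal; simpl; unfold mult; simpl; ring).
apply (is_RInt_fct_extend_pair (U := R_NormedModule) (V := R_NormedModule)).
- apply (is_RInt_ext (fun x => scal c1 (phi x)));
  [|exact (is_RInt_scal (V := R_NormedModule) phi a b c1 _ H)].
  intros x _; unfold scal; simpl; unfold mult; simpl; ring.
- apply (is_RInt_ext (fun x => scal c2 (phi x)));
  [|exact (is_RInt_scal (V := R_NormedModule) phi a b c2 _ H)].
  intros x _; unfold scal; simpl; unfold mult; simpl; ring.
Qed.

(** With equal orders the exponentials cancel and the integral in [lam] gives [2 * PI]. The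
    integrable [phi] stands in for [F * G], whose formula may be singular at the poles. *)
Lemma inner_harm f g c d F G m phi :
  eq_chart f (harm c F m) -> eq_chart g (harm d G m) ->
  (forall x, -1 < x < 1 -> F x * G x = phi x) -> ex_RInt phi (-1) 1 ->
  inner f g = (c * Cconj d * RtoC (2 * PI) * RtoC (RInt phi (-1) 1))%C.
Proof.
intros Hf Hg Hphi Hex. rewrite <- RInt_RtoC by exact Hex.
unfold inner. apply (RInt_ext (V := C_R_CompleteNormedModule)). intros mu Hmu.
rewrite Rmin_left, Rmax_right in Hmu by lra.
rewrite (RInt_ext (V := C_R_CompleteNormedModule) _
  (fun _ => (c * Cconj d * RtoC (phi mu))%C)).
- rewrite (RInt_const (V := C_R_CompleteNormedModule)).
  destruct c, d; apply injective_projections; unfold scal; simpl; unfold mult, prod_scal; simpl;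
    unfold scal; simpl; unfold mult; simpl; ring.
- intros lam Hlam. generalize PI_RGT_0; intros HPI. rewrite Rmin_left, Rmax_right in Hlam by lra.
  rewrite Hf, Hg, <- Hphi by (first [assumption | split; assumption]). unfold harm.
  generalize (sin2_cos2 (m * lam)). unfold Rsqr. generalize (sin (m * lam)) (cos (m * lam)).
  intros s0 c0 E. destruct c as [c1 c2], d as [d1 d2].
  replace (F mu * G mu) with (F mu * G mu * (s0 * s0 + c0 * c0)) by (rewrite E; ring).
  apply injective_projections; simpl; ring.
Qed.

(** * Powers of sqrt (1 - x^2) and reduction to an energy integral *)

Definition derivs (P P1 : R -> R) : Prop := forall x : R, is_derive P x (P1 x).

Lemma sqrt_w_pos x : -1 < x < 1 -> 0 < sqrt (1 - x ^ 2).
Proof. intros Hx; apply sqrt_lt_R0; nra. Qed.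

Lemma sqrt_w_sqr x : -1 < x < 1 -> 1 - x ^ 2 = sqrt (1 - x ^ 2) * sqrt (1 - x ^ 2).
Proof. intros Hx; rewrite sqrt_sqrt; nra. Qed.

Lemma is_derive_sqrt_w_pow a x : -1 < x < 1 ->
  is_derive (fun t => sqrt (1 - t ^ 2) ^ a) x (- INR a * x * sqrt (1 - x ^ 2) ^ a / (1 - x ^ 2)).
Proof.
intros Hx; generalize (sqrt_w_pos x Hx) (sqrt_w_sqr x Hx); intros Hs Ew.
auto_derive; [nra|].
replace (x * (x * 1)) with (x ^ 2) by ring.
replace (1 + - x ^ 2) with (1 - x ^ 2) by ring.
set (s := sqrt (1 - x ^ 2)) in *. rewrite Ew.
destruct a as [|a]; simpl pred; [simpl; field; lra|].
rewrite <- tech_pow_Rmult. field. lra.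
Qed.

Lemma derive_Ioo_sqrt_w_pow a P P1 : derivs P P1 ->
  derive_Ioo (fun x => sqrt (1 - x ^ 2) ^ a * P x)
    (fun x => sqrt (1 - x ^ 2) ^ a * (P1 x - INR a * x * P x / (1 - x ^ 2))).
Proof.
intros HP x Hx.
generalize (is_derive_mult _ _ x _ _ (is_derive_sqrt_w_pow a x Hx) (HP x) Rmult_comm).
unfold mult, plus; simpl. intros H; evar_last; [exact H|].
assert (1 - x ^ 2 <> 0) by nra. simpl; field. simpl in *; lra.
Qed.

(** [((w H')' - m^2 H / w + a H) H] for [H = w^((b+1)/2) f], [f1 = f'], [f2 = f'']: a
    polynomial expression, free of the singularities at the poles. *)
Definition energy (b : nat) (m a : R) (f f1 f2 : R -> R) (x : R) : R :=
  let w := 1 - x ^ 2 in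
  let k := INR b + 1 in
  let s := w * f1 x - k * x * f x in
  let s1 := w * f2 x - 2 * x * f1 x - k * f x - k * x * f1 x in
  w ^ b * ((w * s1 - k * x * s - m ^ 2 * f x) * f x) + a * (w ^ S b * f x ^ 2).

Lemma ex_RInt_derivable (f : R -> R) a b : (forall x, ex_derive f x) -> ex_RInt f a b.
Proof.
intros H; apply (ex_RInt_continuous (V := R_CompleteNormedModule)).
intros x _; apply (ex_derive_continuous (K := R_AbsRing) (V := R_NormedModule)), H.
Qed.

Lemma eq_chart_harm c d F G m :
  (forall x, -1 < x < 1 -> (c * RtoC (F x) = d * RtoC (G x))%C) ->
    eq_chart (harm c F m) (harm d G m).
Proof. intros H lam mu [_ Hm]; unfold harm; rewrite H; auto. Qed.

(** The factor [1 - x^2] clears the denominator and leaves [sqrt (1 - x^2) ^ a] times the smooth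
    [s], so [derive_Ioo_sqrt_w_pow] applies a second time. *)
Lemma derive_Ioo_w_sqrt_w_pow a f f1 f2 : derivs f f1 -> derivs f1 f2 ->
  derive_Ioo (fun x => (1 - x ^ 2) * (sqrt (1 - x ^ 2) ^ a *
    (f1 x - INR a * x * f x / (1 - x ^ 2))))
    (fun x => sqrt (1 - x ^ 2) ^ a *
      ((1 - x ^ 2) * f2 x - 2 * x * f1 x - INR a * f x - INR a * x * f1 x
       - INR a * x * ((1 - x ^ 2) * f1 x - INR a * x * f x) / (1 - x ^ 2))).
Proof.
intros Hf Hf1. set (k := INR a).
set (s := fun x => (1 - x ^ 2) * f1 x - k * x * f x).
set (s1 := fun x => (1 - x ^ 2) * f2 x - 2 * x * f1 x - k * f x - k * x * f1 x).
assert (Ds : derivs s s1).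
{ intros x. unfold s, s1. auto_derive.
  - repeat split; eexists; [apply Hf1|apply Hf].
  - replace (Derive (fun t => f1 t) x) with (f2 x) by (symmetry; apply is_derive_unique, Hf1).
    replace (Derive (fun t => f t) x) with (f1 x) by (symmetry; apply is_derive_unique, Hf). ring.
      }
intros x Hx. apply (is_derive_ext_loc (fun x => sqrt (1 - x ^ 2) ^ a * s x)).
- apply (locally_Ioo (-1) 1); [exact Hx|]. intros t Ht.
  assert (E : sqrt (1 - t ^ 2) ^ a * s t
    = (1 - t ^ 2) * (sqrt (1 - t ^ 2) ^ a * (f1 t - k * t * f t / (1 - t ^ 2)))); [|exact E].
  unfold s. assert (1 - t ^ 2 <> 0) by nra. field. simpl in *; lra.
- exact (derive_Ioo_sqrt_w_pow a s s1 Ds x Hx).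
Qed.

(** [F] and [G] are the latitude profiles of the stream functions and [K w^((b+1)/2) f] is that of
    the bracket, up to constants. The eigenvalue [- a] turns the second term of [MC] into the term
    [a H^2] of the energy. *)
Lemma MC_harm c d F F1 F2 G G1 (m n a K : R) b f f1 f2 f3 :
  derive_Ioo F F1 -> derive_Ioo (fun x => (1 - x ^ 2) * F1 x) F2 ->
  (forall x, -1 < x < 1 -> F2 x - m ^ 2 / (1 - x ^ 2) * F x = - a * F x) ->
  derive_Ioo G G1 -> derivs f f1 -> derivs f1 f2 -> derivs f2 f3 ->
  (forall x, -1 < x < 1 ->
     m * F x * G1 x - n * F1 x * G x = K * (sqrt (1 - x ^ 2) ^ S b * f x)) ->
  MC (grad_perp (harm (RtoC c) F m)) (grad_perp (harm (RtoC d) G n))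
  = RtoC ((c * d * K) ^ 2 * (2 * PI) * RInt (energy b (m + n) a f f1 f2) (-1) 1).
Proof.
intros HF HF2 Heig HG Hf Hf1 Hf2 HB. unfold MC; cbv zeta.
generalize (eq_grad_stream (RtoC c) F F1 m HF) (eq_grad_stream (RtoC d) G G1 n HG).
generalize (stream (grad_perp (harm (RtoC c) F m))) (stream (grad_perp (harm (RtoC d) G n))).
intros u v Hu Hv.
set (H := fun x => sqrt (1 - x ^ 2) ^ S b * f x).
set (k := INR (S b)).
set (s := fun x => (1 - x ^ 2) * f1 x - k * x * f x).
set (s1 := fun x => (1 - x ^ 2) * f2 x - 2 * x * f1 x - k * f x - k * x * f1 x).
set (H1 := fun x => sqrt (1 - x ^ 2) ^ S b * (f1 x - k * x * f x / (1 - x ^ 2))).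
set (H2 := fun x => sqrt (1 - x ^ 2) ^ S b * (s1 x - k * x * s x / (1 - x ^ 2))).
assert (ex_f : forall x, ex_derive (fun t => f t) x) by (intros x; eexists; apply Hf).
assert (ex_f1 : forall x, ex_derive (fun t => f1 t) x) by (intros x; eexists; apply Hf1).
assert (ex_f2 : forall x, ex_derive (fun t => f2 t) x) by (intros x; eexists; apply Hf2).
assert (DH : derive_Ioo H H1) by (apply derive_Ioo_sqrt_w_pow, Hf).
assert (DH1 : derive_Ioo (fun x => (1 - x ^ 2) * H1 x) H2)
  by exact (derive_Ioo_w_sqrt_w_pow (S b) f f1 f2 Hf Hf1).
set (q := (RtoC (c * d * K) * Ci)%C).
assert (HBr : eq_chart (bracket u v) (harm q H (m + n))).
{ eapply eq_chart_trans; [apply eq_grad_bracket; [exact Hu|exact Hv]|].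
  eapply eq_chart_trans; [apply bracket_harm; [exact HF|exact HG]|].
  apply eq_chart_harm. intros x Hx. rewrite HB by exact Hx. unfold q, H.
  apply injective_projections; simpl; ring. }
assert (HL : eq_chart (laplacian (bracket u v))
   (harm q (fun x => H2 x - (m + n) ^ 2 / (1 - x ^ 2) * H x) (m + n))).
{ eapply eq_chart_trans; [apply eq_grad_laplacian, eq_chart_grad; exact HBr|].
  apply laplacian_harm with H1; assumption. }
assert (HBl : eq_chart (bracket (laplacian u) v) (harm (RtoC (- a) * q)%C H (m + n))).
{ assert (Hlu : eq_chart (laplacian u) (harm (RtoC (- a * c)) F m)).
  { eapply eq_chart_trans; [apply eq_grad_laplacian; exact Hu|].
    eapply eq_chart_trans; [apply (laplacian_harm _ _ _ _ _ HF HF2)|].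
    apply eq_chart_harm. intros x Hx. rewrite Heig by exact Hx.
    apply injective_projections; simpl; ring. }
  eapply eq_chart_trans; [apply eq_grad_bracket; [apply eq_chart_grad, Hlu|exact Hv]|].
  eapply eq_chart_trans; [apply bracket_harm; [exact HF|exact HG]|].
  apply eq_chart_harm. intros x Hx. rewrite HB by exact Hx. unfold q, H.
  apply injective_projections; simpl; ring. }
(* Squaring [sqrt (1 - x^2) ^ S b] gives [w^b] and one more [w], which absorbs the denominators.
   Thus [phi1] and [phi2] are differentiable everywhere, poles included. *)
set (phi1 := fun x => (1 - x ^ 2) ^ b * (((1 - x ^ 2) * s1 x - k * x * s x - (m + n) ^ 2 * f x) *
  f x)).
set (phi2 := fun x => (1 - x ^ 2) ^ S b * f x ^ 2).
assert (ex2 : ex_RInt phi2 (-1) 1).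
{ apply ex_RInt_derivable. intros x. unfold phi2. auto_derive. simple apply ex_f. }
assert (ex1 : ex_RInt phi1 (-1) 1).
{ apply ex_RInt_derivable. intros x. unfold phi1, s1, s. auto_derive.
  repeat split; (simple apply ex_f || simple apply ex_f1 || simple apply ex_f2). }
assert (pw : forall x, -1 < x < 1 -> sqrt (1 - x ^ 2) ^ S b * sqrt (1 - x ^ 2) ^ S b =
  (1 - x ^ 2) ^ b * (1 - x ^ 2)).
{ intros x Hx. rewrite <- Rpow_mult_distr, <- sqrt_w_sqr by exact Hx. simpl; ring. }
assert (E1 : forall x, -1 < x < 1 -> (H2 x - (m + n) ^ 2 / (1 - x ^ 2) * H x) * H x = phi1 x).
{ intros x Hx. unfold phi1, H2, H.
  transitivity ((s1 x - k * x * s x / (1 - x ^ 2) - (m + n) ^ 2 / (1 - x ^ 2) * f x) * f x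
     * (sqrt (1 - x ^ 2) ^ S b * sqrt (1 - x ^ 2) ^ S b)); [ring|].
  rewrite pw by exact Hx. assert (1 - x ^ 2 <> 0) by nra. field. simpl in *; lra. }
assert (E2 : forall x, -1 < x < 1 -> H x * H x = phi2 x).
{ intros x Hx. unfold phi2, H.
  transitivity (f x ^ 2 * (sqrt (1 - x ^ 2) ^ S b * sqrt (1 - x ^ 2) ^ S b)); [ring|].
  rewrite pw by exact Hx. simpl; ring. }
rewrite (inner_harm _ _ _ _ _ _ _ phi1 HL HBr E1 ex1),
  (inner_harm _ _ _ _ _ _ _ phi2 HBl HBr E2 ex2).
replace (RInt (energy b (m + n) a f f1 f2) (-1) 1) with (RInt phi1 (-1) 1 + a * RInt phi2 (-1) 1).
- unfold q; apply injective_projections; simpl; ring.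
- symmetry; apply is_RInt_unique.
  apply (is_RInt_ext (V := R_NormedModule) (fun x => plus (phi1 x) (scal a (phi2 x)))).
  + intros x _. unfold energy, phi1, phi2, s1, s, k. rewrite S_INR. reflexivity.
  + apply (is_RInt_plus (V := R_NormedModule)).
    * exact (RInt_correct (V := R_CompleteNormedModule) _ _ _ ex1).
    * apply (is_RInt_scal (V := R_NormedModule)).
      exact (RInt_correct (V := R_CompleteNormedModule) _ _ _ ex2).
Qed.

(** * Associated Legendre functions and spherical harmonics *)

Definition assoc (l m : nat) (x : R) : R := sqrt (1 - x ^ 2) ^ m * rod l (l + m) x.

Definition assoc1 (l m : nat) (x : R) : R :=
  sqrt (1 - x ^ 2) ^ m * (rod l (S (l + m)) x - INR m * x * rod l (l + m) x / (1 - x ^ 2)).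

Definition ynorm (l m : nat) : R :=
  (-1) ^ m * sqrt ((2 * INR l + 1) / (4 * PI) * (INR (fact (l - m)) / INR (fact (l + m))))
  / (2 ^ l * INR (fact l)).

Lemma pow_m1_neq0 m : (-1) ^ m <> 0.
Proof. apply pow_nonzero; lra. Qed.

Lemma ynorm_neq0 l m : ynorm l m <> 0.
Proof.
unfold ynorm, Rdiv.
assert (0 < 2 ^ l * INR (fact l)).
{ apply Rmult_lt_0_compat; [apply pow_lt; lra|apply INR_fact_lt_0]. }
repeat apply Rmult_integral_contrapositive_currified.
- apply pow_m1_neq0.
- apply Rgt_not_eq, sqrt_lt_R0. generalize (pos_INR l) PI_RGT_0; intros.
  repeat apply Rmult_lt_0_compat; try apply Rinv_0_lt_compat; try apply INR_fact_lt_0; lra.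
- apply Rinv_neq_0_compat; lra.
Qed.

Lemma Ynat_harm l m : Ynat l m = harm (RtoC (ynorm l m)) (assoc l m) (INR m).
Proof.
apply functional_extensionality; intros lam; apply functional_extensionality; intros mu.
unfold Ynat, harm, legendre, assoc, ynorm, rod, Rdiv.
apply injective_projections; simpl; ring.
Qed.

Lemma Y_pos l m : Y l (Z.of_nat m) = harm (RtoC (ynorm l m)) (assoc l m) (INR m).
Proof.
apply functional_extensionality; intros lam; apply functional_extensionality; intros mu.
unfold Y. replace (0 <=? Z.of_nat m)%Z with true by (symmetry; apply Z.leb_le; lia).
rewrite Nat2Z.id, Ynat_harm; reflexivity.
Qed.

Lemma Y_neg l m : (0 < m)%nat ->
  Y l (- Z.of_nat m) = harm (RtoC ((-1) ^ m * ynorm l m)) (assoc l m) (- INR m).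
Proof.
intros Hm; apply functional_extensionality; intros lam; apply functional_extensionality; intros mu.
unfold Y. replace (0 <=? - Z.of_nat m)%Z with false by (symmetry; apply Z.leb_gt; lia).
rewrite Z.opp_involutive, Nat2Z.id, Ynat_harm. unfold harm.
rewrite Ropp_mult_distr_l_reverse, cos_neg, sin_neg.
apply injective_projections; simpl; ring.
Qed.

Lemma derivs_rod l n : derivs (rod l n) (rod l (S n)).
Proof. intros x; apply is_derive_rod. Qed.

Lemma derive_Ioo_assoc l m : derive_Ioo (assoc l m) (assoc1 l m).
Proof. apply derive_Ioo_sqrt_w_pow, derivs_rod. Qed.

(** The associated Legendre equation, obtained from [rod_ode] at index [l + m] by carrying the
    factor [sqrt (1 - x^2) ^ m] through. *)
Lemma assoc_eigen l m : exists2 F2, derive_Ioo (fun x => (1 - x ^ 2) * assoc1 l m x) F2 &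
  forall x, -1 < x < 1 ->
    F2 x - INR m ^ 2 / (1 - x ^ 2) * assoc l m x = - (INR l * (INR l + 1)) * assoc l m x.
Proof.
eexists.
- apply derive_Ioo_w_sqrt_w_pow; apply derivs_rod.
- intros x Hx. generalize (rod_ode l (l + m) x). rewrite plus_INR. unfold assoc.
  assert (w0 : 1 - x ^ 2 <> 0) by nra. revert w0.
  generalize (sqrt (1 - x ^ 2) ^ m) (rod l (l + m) x) (rod l (S (l + m)) x)
    (rod l (S (S (l + m))) x).
  generalize (INR l) (INR m). intros a b s p p1 p2 w0 E.
  cbv beta. field_simplify_eq; [|simpl in *; lra].
  assert (E' : p2 = (2 * (a + b + 1 - a) * x * p1 + (a + b + 1) * (a + b - 2 * a) * p) /
    (1 - x ^ 2)).
  { rewrite <- E. field. simpl in *; lra. }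
  rewrite E'. field. simpl in *; lra.
Qed.

(** * Positivity of the energies and of the criterion *)

Lemma RInt_gt0_exact (phi g B B' : R -> R) :
  derivs B B' -> (forall x, ex_derive B' x) -> B 1 = B (-1) -> ex_RInt phi (-1) 1 ->
    ex_RInt g (-1) 1 ->
  (forall x, -1 < x < 1 -> B' x + g x <= phi x) -> 0 < RInt g (-1) 1 -> 0 < RInt phi (-1) 1.
Proof.
intros HB HB' E Hphi Hg Hle Hpos.
assert (H : is_RInt (fun x => plus (B' x) (g x)) (-1) 1
  (plus (minus (B 1) (B (-1))) (RInt g (-1) 1))).
{ apply (is_RInt_plus (V := R_NormedModule));
  [|exact (RInt_correct (V := R_CompleteNormedModule) _ _ _ Hg)].
  apply (is_RInt_derive (V := R_CompleteNormedModule)); intros x _; [apply HB|].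
  apply (ex_derive_continuous (K := R_AbsRing) (V := R_NormedModule)), HB'. }
rewrite E, minus_eq_zero, plus_zero_l in H.
apply (Rlt_le_trans _ _ _ Hpos). rewrite <- (is_RInt_unique _ _ _ _ H).
apply RInt_le; [lra|eexists; exact H|exact Hphi|exact Hle].
Qed.

Lemma ex_RInt_energy b m a f f1 f2 f3 : derivs f f1 -> derivs f1 f2 -> derivs f2 f3 ->
  ex_RInt (energy b m a f f1 f2) (-1) 1.
Proof.
intros Hf Hf1 Hf2. apply ex_RInt_derivable. intros x. unfold energy.
assert (ex_f : ex_derive (fun t => f t) x) by (eexists; apply Hf).
assert (ex_f1 : ex_derive (fun t => f1 t) x) by (eexists; apply Hf1).
assert (ex_f2 : ex_derive (fun t => f2 t) x) by (eexists; apply Hf2).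
auto_derive. repeat split; (simple apply ex_f || simple apply ex_f1 || simple apply ex_f2).
Qed.

Lemma Cpos_sqr_mult r s : r <> 0 -> 0 < s -> Cpos (RtoC (r ^ 2 * (2 * PI) * s)).
Proof.
intros Hr Hs; split; [reflexivity|]. simpl Re. generalize PI_RGT_0; intros HPI.
apply Rmult_lt_0_compat; [apply Rmult_lt_0_compat; [now apply pow2_gt_0|lra]|exact Hs].
Qed.

(** By the ODE of [f], this energy is an exact derivative plus
    [w^(n+k+1) f^2 (2 (n+1) (k+1) - (k+1)^2 (1 + x^2))], and [k <= n]. *)
Lemma energy_sectoral_gt0 l n k : (k <= n)%nat -> (S n <= l)%nat ->
  0 < RInt (energy (S (n + k)) (INR n - INR k) (INR l * (INR l + 1))
        (rod l (l + S n)) (rod l (S (l + S n))) (rod l (S (S (l + S n))))) (-1) 1.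
Proof.
intros Hk Hn.
set (f := rod l (l + S n)). set (f1 := rod l (S (l + S n))). set (f2 := rod l (S (S (l + S n)))).
assert (Df : derivs f f1) by apply derivs_rod.
assert (Df1 : derivs f1 f2) by apply derivs_rod.
set (k1 := INR (S k)). set (b := S (n + k)).
assert (ex_f : forall x, ex_derive (fun t => f t) x) by (intros x; eexists; apply Df).
assert (ex_f1 : forall x, ex_derive (fun t => f1 t) x) by (intros x; eexists; apply Df1).
(* As [k <= n], the last factor of the nonnegative part is at least [(k+1)^2 (1 - x^2)]; this
   accounts for the additional power of [w]. *)
set (g := fun x => k1 ^ 2 * ((1 - x ^ 2) ^ S b * f x ^ 2)).
assert (ex0 : ex_RInt (fun x => (1 - x ^ 2) ^ S b * f x ^ 2) (-1) 1).
{ apply ex_RInt_derivable; intros x. auto_derive. simple apply ex_f. }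
apply (RInt_gt0_exact _ g (fun x => - k1 * x * (1 - x ^ 2) ^ S b * f x ^ 2)
  (fun x => - k1 * (1 - x ^ 2) ^ S b * f x ^ 2 + 2 * k1 * INR (S b) * x ^ 2 * (1 - x ^ 2) ^ b *
    f x ^ 2
     - 2 * k1 * x * (1 - x ^ 2) ^ S b * f x * f1 x)).
- clearbody b. intros x. auto_derive; [simple apply ex_f|].
  change (match b with 0%nat => 1 | S _ => INR b + 1 end) with (INR (S b)).
  replace (Derive (fun t => f t) x) with (f1 x) by (symmetry; apply is_derive_unique, Df).
  replace (1 + - (x * (x * 1))) with (1 - x ^ 2) by ring. simpl pred.
  rewrite <- (tech_pow_Rmult (1 - x ^ 2) b). ring.
- intros x. auto_derive. repeat split; (simple apply ex_f || simple apply ex_f1).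
- simpl; ring.
- apply (ex_RInt_energy _ _ _ _ _ _ (rod l (S (S (S (l + S n))))));
  [exact Df|exact Df1|apply derivs_rod].
- exact (ex_RInt_scal (V := R_NormedModule) _ (-1) 1 (k1 ^ 2) ex0).
- intros x Hx. generalize (rod_ode l (l + S n) x). fold f f1 f2. rewrite plus_INR.
  unfold energy, g, k1, b. rewrite <- !(tech_pow_Rmult (1 - x ^ 2)), !S_INR, plus_INR.
  assert (Hw : 0 <= (1 - x ^ 2) ^ (n + k)) by (apply pow_le; nra).
  revert Hw. generalize ((1 - x ^ 2) ^ (n + k)) (f x) (f1 x) (f2 x). intros W p p1 p2 HW E.
  assert (Hkn : INR k <= INR n) by (apply le_INR; exact Hk).
  generalize (pos_INR k) Hkn. revert E. generalize (INR l) (INR n) (INR k). intros L N K E HK HN.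
  assert (Ew : (1 - x ^ 2) * p2 = 2 * (N + 2) * x * p1 + (L + N + 2) * (N + 1 - L) * p) by lra.
  apply Rminus_le_0.
  (* What remains is [2 (k+1) (n-k) w^(n+k+1) f^2] plus a multiple of the ODE, which is zero. *)
  match goal with |- 0 <= ?e => replace e with
   ((1 - x ^ 2) * W * p ^ 2 * (2 * (K + 1) * (N - K))
     + W * (1 - x ^ 2) ^ 2 * p * ((1 - x ^ 2) * p2 -
       (2 * (N + 2) * x * p1 + (L + N + 2) * (N + 1 - L) * p))) by ring end.
  rewrite Ew, Rminus_diag, Rmult_0_r, Rplus_0_r.
  apply Rmult_le_pos; [|apply Rmult_le_pos; lra].
  apply Rmult_le_pos; [apply Rmult_le_pos; [nra|exact HW]|apply pow2_ge_0].
- replace (RInt g (-1) 1) with (k1 ^ 2 * RInt (fun x => (1 - x ^ 2) ^ S b * f x ^ 2) (-1) 1)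
    by (symmetry; exact (RInt_scal (V := R_CompleteNormedModule) _ (-1) 1 (k1 ^ 2) ex0)).
  apply Rmult_lt_0_compat; [apply pow_lt, lt_0_INR; lia|]. apply RInt_rod_gt0. lia.
Qed.

(** The second profile is a pure power of [sqrt (1 - x^2)], so the bracket involves only two
    consecutive derivatives of the first polynomial; the ODE turns this combination into the single
    derivative one order below. *)
Lemma MC_sectoral_pos l n k : (k <= n)%nat -> (S n < l)%nat ->
  Cpos (MC (e l (Z.of_nat (S (S n)))) (e (S (S k)) (- Z.of_nat (S (S k))))).
Proof.
intros Hk Hn. unfold e. rewrite Y_pos, Y_neg by lia.
destruct (rod_diag (S (S k))) as [q Hq Eq].
destruct (assoc_eigen l (S (S n))) as [F2 HF2 Heig].
set (m1 := INR (S (S n))). set (m := INR (S (S k))).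
(* The last factor is the zeroth-order coefficient of [rod_ode] at index [l + S n]; it is nonzero
   because [n + 1 < l]. *)
set (K := m * q * ((INR l + INR n + 2) * (INR n + 1 - INR l))).
rewrite (MC_harm _ _ _ _ F2 _ _ _ _ _ K (S (n + k)) (rod l (l + S n)) (rod l (S (l + S n)))
  (rod l (S (S (l + S n)))) (rod l (S (S (S (l + S n))))) (derive_Ioo_assoc _ _) HF2 Heig
  (derive_Ioo_assoc _ _) (derivs_rod _ _) (derivs_rod _ _) (derivs_rod _ _)).
- apply Cpos_sqr_mult.
  + apply lt_INR in Hn. rewrite S_INR in Hn. generalize (pos_INR n) (pos_INR l); intros.
    assert (Hm : m <> 0) by (unfold m; apply not_0_INR; lia).
    pose proof Rmult_integral_contrapositive_currified as nz.
    apply nz; [apply nz; [|apply nz]|apply nz; [apply nz|apply nz]];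
      auto using ynorm_neq0, pow_m1_neq0; lra.
  + replace (INR (S (S n)) + - m) with (INR n - INR k) by (unfold m; rewrite !S_INR; ring).
    exact (energy_sectoral_gt0 l n k Hk (Nat.lt_le_incl _ _ Hn)).
- intros x Hx. unfold assoc, assoc1.
  rewrite Eq. replace (rod (S (S k)) (S (S (S k) + S (S k))) x) with 0.
  2 : { symmetry. rewrite <- (is_derive_unique _ _ _ (derivs_rod _ _ x)).
    rewrite (Derive_ext _ (fun _ => q)) by exact Eq. apply Derive_const. }
  replace (l + S (S n))%nat with (S (l + S n)) by lia.
  fold m1 m.
  assert (w0 : 1 - x ^ 2 <> 0) by nra.
  assert (Es : sqrt (1 - x ^ 2) ^ S (S n) * sqrt (1 - x ^ 2) ^ S (S k)
     = (1 - x ^ 2) * sqrt (1 - x ^ 2) ^ S (S (n + k))).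
  { rewrite (sqrt_w_sqr x Hx) at 3. rewrite <- pow_add. replace (S (S n) + S (S k))%nat with
    (S (S (S (S (n + k))))) by lia.
    simpl; ring. }
  generalize (rod_ode l (l + S n) x). rewrite plus_INR, S_INR. intros E.
  transitivity (m * q * (sqrt (1 - x ^ 2) ^ S (S n) * sqrt (1 - x ^ 2) ^ S (S k)) / (1 - x ^ 2) *
    ((1 - x ^ 2) * rod l (S (S (l + S n))) x - 2 * m1 * x * rod l (S (l + S n)) x)).
  { field. simpl in *; lra. }
  rewrite Es, E. unfold K, m1. rewrite !S_INR. field. simpl in *; lra.
Qed.

(** With [h = w^2 f], so that [h' = (a - b) w p q], this energy is an exact derivative plus
    [a w^2 f^2 - h'^2 / w], where [a = n (n + 3)] and [b = k (k + 3)]. *)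
Lemma energy_tesseral_gt0 n k : (1 <= k < n)%nat ->
  let p := rod (S n) (S (S n)) in let p1 := rod (S n) (S (S (S n))) in
  let p2 := rod (S n) (S (S (S (S n)))) in
  let q := rod (S k) (S (S k)) in let q1 := rod (S k) (S (S (S k))) in
  let q2 := rod (S k) (S (S (S (S k)))) in
  forall f f1 f2 f3 : R -> R, derivs f f1 -> derivs f1 f2 -> derivs f2 f3 ->
  (forall x, f x = p x * q1 x - p1 x * q x) ->
  (forall x, f1 x = p x * q2 x - p2 x * q x) ->
  0 < RInt (energy 1 2 (INR (S n) * (INR (S n) + 1)) f f1 f2) (-1) 1.
Proof.
intros Hkn p p1 p2 q q1 q2 f f1 f2 f3 Df Df1 Df2 Ef Ef1.
assert (ex_f : forall x, ex_derive (fun t => f t) x) by (intros x; eexists; apply Df).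
assert (ex_f1 : forall x, ex_derive (fun t => f1 t) x) by (intros x; eexists; apply Df1).
assert (ex_f2 : forall x, ex_derive (fun t => f2 t) x) by (intros x; eexists; apply Df2).
generalize (RInt_bracket_rod_gt0 Hkn); cbv zeta; fold p p1 q q1.
set (a := INR n * (INR n + 3)). set (b := INR k * (INR k + 3)).
set (g := fun x => a * (1 - x ^ 2) ^ 2 * (p x * q1 x - p1 x * q x) ^ 2
  - (a - b) ^ 2 * (1 - x ^ 2) * p x ^ 2 * q x ^ 2). intros Hg.
(* This primitive is [h h' / w] for [h = w^2 f]; it vanishes at both ends. *)
apply (RInt_gt0_exact _ g (fun x => (1 - x ^ 2) ^ 3 * f x * f1 x - 4 * x * (1 - x ^ 2) ^ 2 *
  f x ^ 2)
  (fun x => - 6 * x * (1 - x ^ 2) ^ 2 * f x * f1 x + (1 - x ^ 2) ^ 3 * (f1 x ^ 2 + f x * f2 x)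
   - 4 * (1 - x ^ 2) ^ 2 * f x ^ 2 + 16 * x ^ 2 * (1 - x ^ 2) * f x ^ 2 - 8 * x *
     (1 - x ^ 2) ^ 2 * f x * f1 x)).
- intros x. auto_derive; [repeat split; (simple apply ex_f || simple apply ex_f1)|].
  replace (Derive (fun t => f t) x) with (f1 x) by (symmetry; apply is_derive_unique, Df).
  replace (Derive (fun t => f1 t) x) with (f2 x) by (symmetry; apply is_derive_unique, Df1). ring.
- intros x. auto_derive. repeat split; (simple apply ex_f || simple apply ex_f1 || simple apply
  ex_f2).
- simpl; ring.
- exact (ex_RInt_energy _ _ _ _ _ _ _ Df Df1 Df2).
- assert (ex_p : forall x, ex_derive (fun t => p t) x) by (intros x; eexists; apply derivs_rod).
  assert (ex_p1 : forall x, ex_derive (fun t => p1 t) x) by (intros x; eexists; apply derivs_rod).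
  assert (ex_q : forall x, ex_derive (fun t => q t) x) by (intros x; eexists; apply derivs_rod).
  assert (ex_q1 : forall x, ex_derive (fun t => q1 t) x) by (intros x; eexists; apply derivs_rod).
  clearbody p p1 p2 q q1 q2.
  apply ex_RInt_derivable; intros x. unfold g. auto_derive.
  repeat split; (simple apply ex_p || simple apply ex_p1 || simple apply ex_q || simple apply
    ex_q1).
- intros x Hx. right.
  assert (Ep : (1 - x ^ 2) * p2 x = 4 * x * p1 x - a * p x).
  { unfold p2, p1, p, a. rewrite rod_ode, !S_INR. ring. }
  assert (Eq : (1 - x ^ 2) * q2 x = 4 * x * q1 x - b * q x).
  { unfold q2, q1, q, b. rewrite rod_ode, !S_INR. ring. }
  (* This is [h' / w]: the first-order terms of the two ODEs combine into [4 x f]. *)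
  assert (Ew : (1 - x ^ 2) * f1 x - 4 * x * f x = (a - b) * p x * q x).
  { rewrite Ef, Ef1. transitivity (p x * ((1 - x ^ 2) * q2 x) - q x * ((1 - x ^ 2) * p2 x)
      - 4 * x * (p x * q1 x - p1 x * q x)); [ring|]. rewrite Ep, Eq; ring. }
  unfold g. rewrite <- Ef.
  replace ((a - b) ^ 2 * (1 - x ^ 2) * p x ^ 2 * q x ^ 2)
    with ((1 - x ^ 2) * ((1 - x ^ 2) * f1 x - 4 * x * f x) ^ 2) by (rewrite Ew; ring).
  unfold energy, a. rewrite !S_INR. simpl (INR 0). ring.
- exact Hg.
Qed.

(** Both orders are 1, so the terms with denominator [1 - x^2] cancel in the bracket, whose profile
    is [w] times the Wronskian [f] of [p] and [q]. *)
Lemma MC_tesseral_pos n k : (1 <= k < n)%nat -> Cpos (MC (e (S n) 1) (e (S k) 1)).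
Proof.
intros Hkn. unfold e. change 1%Z with (Z.of_nat 1). rewrite !Y_pos.
destruct (assoc_eigen (S n) 1) as [F2 HF2 Heig].
set (p := rod (S n) (S (S n))). set (p1 := rod (S n) (S (S (S n)))).
set (p2 := rod (S n) (S (S (S (S n))))). set (p3 := rod (S n) (S (S (S (S (S n)))))).
set (p4 := rod (S n) (S (S (S (S (S (S n))))))).
set (q := rod (S k) (S (S k))). set (q1 := rod (S k) (S (S (S k)))).
set (q2 := rod (S k) (S (S (S (S k))))). set (q3 := rod (S k) (S (S (S (S (S k)))))).
set (q4 := rod (S k) (S (S (S (S (S (S k))))))).
assert (dp : derivs p p1) by apply derivs_rod. assert (dp1 : derivs p1 p2) by apply derivs_rod.
assert (dp2 : derivs p2 p3) by apply derivs_rod. assert (dp3 : derivs p3 p4) by apply derivs_rod.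
assert (dq : derivs q q1) by apply derivs_rod. assert (dq1 : derivs q1 q2) by apply derivs_rod.
assert (dq2 : derivs q2 q3) by apply derivs_rod. assert (dq3 : derivs q3 q4) by apply derivs_rod.
assert (mult_d : forall u u1 v v1 r r1 t t1, derivs u u1 -> derivs v v1 -> derivs r r1 ->
  derivs t t1 ->
  derivs (fun x => u x * v x - r x * t x) (fun x => (u1 x * v x + u x * v1 x) -
    (r1 x * t x + r x * t1 x))).
{ intros u u1 v v1 r r1 t t1 Hu Hv Hr Ht x.
  exact (is_derive_minus (V := R_NormedModule) _ _ x _ _
    (is_derive_mult _ _ x _ _ (Hu x) (Hv x) Rmult_comm)
      (is_derive_mult _ _ x _ _ (Hr x) (Ht x) Rmult_comm)). }
assert (ext_d : forall u v v', derivs u v -> (forall x, v x = v' x) -> derivs u v').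
{ intros u v v' H E x. rewrite <- E. apply H. }
set (f := fun x => p x * q1 x - p1 x * q x).
set (f1 := fun x => p x * q2 x - p2 x * q x).
assert (Df : derivs f f1).
{ eapply ext_d; [exact (mult_d _ _ _ _ _ _ _ _ dp dq1 dp1 dq)|]. intros x; unfold f1; cbv beta;
  ring. }
pose proof (mult_d _ _ _ _ _ _ _ _ dp dq2 dp2 dq) as Df1.
set (f2 := fun x => (p1 x * q2 x + p x * q3 x) - (p3 x * q x + p2 x * q1 x)).
fold f1 in Df1. change (derivs f1 f2) in Df1.
assert (Df2 : exists f3, derivs f2 f3).
{ eexists. intros x.
  exact (is_derive_minus (V := R_NormedModule) _ _ x _ _
   (is_derive_plus (V := R_NormedModule) _ _ x _ _
    (is_derive_mult _ _ x _ _ (dp1 x) (dq2 x) Rmult_comm)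
      (is_derive_mult _ _ x _ _ (dp x) (dq3 x) Rmult_comm))
   (is_derive_plus (V := R_NormedModule) _ _ x _ _
    (is_derive_mult _ _ x _ _ (dp3 x) (dq x) Rmult_comm)
      (is_derive_mult _ _ x _ _ (dp2 x) (dq1 x) Rmult_comm))). }
destruct Df2 as [f3 Df2].
rewrite (MC_harm _ _ _ _ F2 _ _ _ _ _ 1 1 f f1 f2 f3 (derive_Ioo_assoc _ _) HF2 Heig
  (derive_Ioo_assoc _ _) Df Df1 Df2).
- apply Cpos_sqr_mult.
  + pose proof Rmult_integral_contrapositive_currified as nz.
    apply nz; [apply nz; apply ynorm_neq0|lra].
  + replace (INR 1 + INR 1) with 2 by (simpl; ring).
    apply (energy_tesseral_gt0 n k Hkn f f1 f2 f3 Df Df1 Df2); reflexivity.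
- intros x Hx. unfold assoc, assoc1. rewrite !(Nat.add_comm _ 1). simpl Nat.add.
  fold p p1 q q1. unfold f. assert (w0 : 1 - x ^ 2 <> 0) by nra.
  rewrite !pow_1, <- !(tech_pow_Rmult _ 1), pow_1. simpl (INR 1). field. simpl in *; lra.
Qed.

Theorem theorem3p4 :
  (forall (l1 : nat) (m1 : Z),
     (1 < Z.abs m1 <= Z.of_nat l1)%Z ->
     forall m : Z, (2 <= m <= m1)%Z ->
       Cpos (MC (e l1 m1) (e (Z.to_nat m) (- m)%Z)))
  /\
  (forall l1 : nat, (3 <= l1)%nat ->
     forall l2 : Z, (2 <= l2 < Z.of_nat l1)%Z ->
       Cpos (MC (e l1 1%Z) (e (Z.to_nat l2) 1%Z))).
Proof.
split.
- intros l1 m1 H1 m Hm.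
  (* Here [n = m1 - 2] and [k = m - 2]; [2 <= m <= m1] makes [m1] positive. *)
  replace m1 with (Z.of_nat (S (S (Z.to_nat (m1 - 2))))) by lia.
  replace (Z.to_nat m) with (S (S (Z.to_nat (m - 2)))) by lia.
  replace (- m)%Z with (- Z.of_nat (S (S (Z.to_nat (m - 2)))))%Z by lia.
  apply MC_sectoral_pos; lia.
- intros l1 H1 l2 H2.
  replace l1 with (S (l1 - 1)) by lia.
  replace (Z.to_nat l2) with (S (Z.to_nat (l2 - 1))) by lia.
  apply MC_tesseral_pos; lia.
Qed.
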